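(* Let $n\ge2$. Suppose every $f_i:\mathbb{R}^d\to\mathbb{R}$ is differentiable with $L$-Lipschitz gradient (not necessarily convex), $F=\frac1n\sum_{i=1}^nf_i$ is $\mu$-strongly convex with $0<\mu\le L$, and, for some $\nu\in(0,1]$ and $\rho_\nu\ge0$, $F$ is twice differentiable with $\|\nabla^2F(u)-\nabla^2F(v)\|_{\mathrm{op}}\le\rho_\nu\|u-v\|^\nu$ for all $u,v$; let $\psi:\mathbb{R}^d\to\mathbb{R}\cup\{+\infty\}$ be proper, closed and convex. Let $x^\dagger$ be the unique minimizer of $\mathcal P=F+\psi$ and $\beta_\star=\|\nabla F(x^\dagger)\|$. Let $K\ge1$, $T=nK\ge3$, run ProxRR with constant component stepsize $\eta=\frac{4\log T}{\mu T}$, and suppose $K\ge256\frac{L^2}{\mu^2}\log T$. Then $$ \mathbb{E}\|y_K-x^\dagger\|^2=\widetilde{\mathcal O}\left(\frac{\beta_\star^2}{K^2}+T^{-2}+n^2T^{-3}+n^{1+\nu}T^{-2-2\nu}\right). $$ If $\nu\ge\frac12$, this reduces to $$ \mathbb{E}\|y_K-x^\dagger\|^2=\widetilde{\mathcal O}\left(\frac{\beta_\star^2}{K^2}+\frac1{(nK)^2}+\frac1{nK^3}\right). $$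
   Context: ProxRR (one proximal step per epoch) with constant component stepsize $\eta>0$ and $h=n\eta$ starts from a deterministic $y_0\in\mathbb{R}^d$. At each epoch $k=0,1,\dots$ it draws a fresh, independent, uniformly random permutation $\pi_k$ of $\{1,\dots,n\}$, sets $x_{k,0}=y_k$, performs $x_{k,i}=x_{k,i-1}-\eta\nabla f_{\pi_k(i)}(x_{k,i-1})$ for $i=1,\dots,n$, and sets $y_{k+1}=\operatorname{prox}_{h\psi}(x_{k,n})$, where $\operatorname{prox}_{\tau\psi}(z):=\operatorname{argmin}_u\{\tau\psi(u)+\frac12\|u-z\|^2\}$. Expectations are over the permutations. Constants: $G_{\star,\mathrm c}:=\max_i\|\nabla f_i(x^\dagger)\|$, $D_{\mathrm c}:=\max\{\|y_0-x^\dagger\|,\,G_{\star,\mathrm c}/(2L)\}$, $G_{\mathrm c}:=G_{\star,\mathrm c}+2LD_{\mathrm c}$. The notation $\widetilde{\mathcal O}(\phi)$ means a bound $C(\log T)^p\phi$ with $p$ an absolute constant and $C$ depending only on the fixed problem parameters $L,\mu,\rho_\nu,\nu,G_{\mathrm c},D_{\mathrm c}$ (not on $n,K$). *)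

(* Defs.v *)
From mathcomp Require Import all_boot all_order all_fingroup all_algebra.
From mathcomp Require Import all_classical all_reals all_analysis.

Set Implicit Arguments.
Unset Strict Implicit.
Unset Printing Implicit Defensive.

Import Order.TTheory GRing.Theory Num.Theory.
Import numFieldNormedType.Exports.

Local Open Scope classical_set_scope.
Local Open Scope ring_scope.

(* The library norm `|u| on 'rV[R]_d is the sup norm, hence this definition.
   The two norms are equivalent, so [differentiable] and [closed] keep their
   usual meaning on R^d. *)
Definition enorm (R : realType) (d : nat) (u : 'rV[R]_d) : R :=
  Num.sqrt (\sum_(j < d) u 0 j ^+ 2).

(* Row-vector convention: A acts by u |-> u *m A. *)
Definition opnorm (R : realType) (d : nat) (A : 'M[R]_d) : R :=
  sup [set enorm (u *m A) | u in [set u : 'rV[R]_d | enorm u <= 1]].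

Definition grad (R : realType) (d : nat) (f : 'rV[R]_d -> R) (x : 'rV[R]_d) :
    'rV[R]_d :=
  \row_(j < d) 'D_(delta_mx 0 j) f x.

Definition hess (R : realType) (d : nat) (f : 'rV[R]_d -> R) (x : 'rV[R]_d) :
    'M[R]_d :=
  jacobian (grad f) x.

Definition lipschitz_gradient (R : realType) (d : nat) (L : R)
    (f : 'rV[R]_d -> R) : Prop :=
  (forall x, differentiable f x) /\
  (forall u v, enorm (grad f u - grad f v) <= L * enorm (u - v)).

Definition holder_hessian (R : realType) (d : nat) (rho nu : R)
    (f : 'rV[R]_d -> R) : Prop :=
  [/\ forall x, differentiable f x,
      forall x, differentiable (grad f) x &
      forall u v, opnorm (hess f u - hess f v) <= rho * enorm (u - v) `^ nu].

Definition strongly_convex (R : realType) (d : nat) (mu : R)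
    (f : 'rV[R]_d -> R) : Prop :=
  forall (u v : 'rV[R]_d) (t : R), 0 <= t <= 1 ->
    f (t *: u + (1 - t) *: v) <=
    t * f u + (1 - t) * f v - mu / 2 * t * (1 - t) * enorm (u - v) ^+ 2.

Definition proper_fun (R : realType) (d : nat) (psi : 'rV[R]_d -> \bar R) :
    Prop :=
  (forall x, (-oo < psi x)%E) /\ (exists x, (psi x < +oo)%E).

Definition closed_fun (R : realType) (d : nat) (psi : 'rV[R]_d -> \bar R) :
    Prop :=
  closed [set p : 'rV[R]_d * R | (psi p.1 <= p.2%:E)%E].

Definition convex_fun (R : realType) (d : nat) (psi : 'rV[R]_d -> \bar R) :
    Prop :=
  forall (u v : 'rV[R]_d) (t : R), 0 < t < 1 ->
    (psi (t *: u + (1 - t) *: v)%R <= t%:E * psi u + (1 - t)%R%:E * psi v)%E.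

Definition argmin (R : realType) (d : nat) (g : 'rV[R]_d -> \bar R) :
    set 'rV[R]_d :=
  [set x | forall u, (g x <= g u)%E].

(* [get] picks an element of the set, and is arbitrary on the empty set; for
   tau > 0 and psi proper, closed and convex the argmin is a singleton. *)
Definition prox (R : realType) (d : nat) (tau : R) (psi : 'rV[R]_d -> \bar R)
    (z : 'rV[R]_d) : 'rV[R]_d :=
  get (argmin (fun u => (tau%:E * psi u + (2^-1 * enorm (u - z) ^+ 2)%R%:E)%E)).

Definition mean_fun (R : realType) (d n : nat) (f : 'I_n -> 'rV[R]_d -> R)
    (x : 'rV[R]_d) : R :=
  n%:R^-1 * \sum_(i < n) f i x.

(* [enum 'I_n] is 0, ..., n-1 in increasing order, so the component functions
   are visited in the order f (s 0), ..., f (s (n-1)). *)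
Definition epoch (R : realType) (d n : nat) (f : 'I_n -> 'rV[R]_d -> R)
    (eta : R) (s : 'S_n) (y : 'rV[R]_d) : 'rV[R]_d :=
  foldl (fun x i => x - eta *: grad (f (s i)) x) y (enum 'I_n).

(* The iterate reached from y0 after one epoch per permutation in the list. *)
Definition proxRR (R : realType) (d n : nat) (f : 'I_n -> 'rV[R]_d -> R)
    (psi : 'rV[R]_d -> \bar R) (eta : R) (y0 : 'rV[R]_d) (s : seq 'S_n) :
    'rV[R]_d :=
  foldl (fun y sk => prox (n%:R * eta) psi (epoch f eta sk y)) y0 s.

(* Independent uniform permutations pi_0, ..., pi_(K-1) have the uniform law on
   K-tuples. *)
Definition expect_perms (R : realType) (n K : nat)
    (X : K.-tuple 'S_n -> R) : R :=
  (\sum_(s : K.-tuple 'S_n) X s) / #|{: K.-tuple 'S_n}|%:R.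

Definition Gstar (R : realType) (d n : nat) (f : 'I_n -> 'rV[R]_d -> R)
    (xdag : 'rV[R]_d) : R :=
  \big[Num.max/0]_(i < n) enorm (grad (f i) xdag).

Definition Dconst (R : realType) (d n : nat) (L : R)
    (f : 'I_n -> 'rV[R]_d -> R) (y0 xdag : 'rV[R]_d) : R :=
  Num.max (enorm (y0 - xdag)) (Gstar f xdag / (2 * L)).

Definition Gconst (R : realType) (d n : nat) (L : R)
    (f : 'I_n -> 'rV[R]_d -> R) (y0 xdag : 'rV[R]_d) : R :=
  Gstar f xdag + 2 * L * Dconst L f y0 xdag.

(* Main.v *)
(** With [h = n * eta], one epoch is the exact prox-gradient step [y - h grad F y]
    perturbed by [h e], where [e] averages [grad f_i (x_i) - grad f_i (y)] along
    the epoch.  The prox step is nonexpansive around the minimizer, so the mean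
    square error contracts by [1 - h mu] up to [h |E e|^2 / mu + h^2 E |e|^2].
    The second moment of [e] is of order [h^2 |grad F y|^2 + h^2 / n], because
    increments drawn without replacement are negatively correlated.  The bias
    [E e] is smaller: replace [x_i] by [z_i = y - eta W_i], with [W_i] the prefix
    sum of the centred gradients at [y]; swap the current index with a uniform
    one, at cost [O(eta)], which turns [grad f_i] into [grad F]; the first-order
    term [hess F (y) W_i] then has mean zero, and the Hölder remainder is
    [E |eta W_i| ^ (1 + nu) = O((h^2 / n) ^ ((1 + nu) / 2))].  Only [F], not the
    components, needs a Hessian. *)

Require Import Defs.
From mathcomp Require Import all_boot all_order all_fingroup all_algebra.
From mathcomp Require Import all_classical all_reals all_analysis.
From mathcomp Require Import ring lra.

Set Implicit Arguments.
Unset Strict Implicit.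
Unset Printing Implicit Defensive.

Import Order.TTheory GRing.Theory Num.Theory.
Import numFieldNormedType.Exports.

Local Open Scope classical_set_scope.
Local Open Scope ring_scope.

(** * Euclidean norm *)

Section EuclideanSpace.
Context {R : realType} {d : nat}.
Implicit Types (u v w : 'rV[R]_d) (a : R).

Definition dot u v : R := \sum_(j < d) u 0 j * v 0 j.

Lemma dotC u v : dot u v = dot v u.
Proof. by apply: eq_bigr => j _; rewrite mulrC. Qed.

Lemma dotDl u v w : dot (u + v) w = dot u w + dot v w.
Proof.
by rewrite /dot -big_split; apply: eq_bigr => j _; rewrite mxE mulrDl.
Qed.

Lemma dotZl a u v : dot (a *: u) v = a * dot u v.
Proof. by rewrite /dot mulr_sumr; apply: eq_bigr => j _; rewrite mxE mulrA. Qed.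

Lemma dotNl u v : dot (- u) v = - dot u v.
Proof. by rewrite -scaleN1r dotZl mulN1r. Qed.

Lemma dot0l u : dot 0 u = 0.
Proof. by rewrite -(scale0r 0) dotZl mul0r. Qed.

Lemma dotDr u v w : dot w (u + v) = dot w u + dot w v.
Proof. by rewrite dotC dotDl !(dotC _ w). Qed.

Lemma dotZr a u v : dot u (a *: v) = a * dot u v.
Proof. by rewrite dotC dotZl dotC. Qed.

Lemma dotNr u v : dot u (- v) = - dot u v.
Proof. by rewrite dotC dotNl dotC. Qed.

Lemma dot0r u : dot u 0 = 0.
Proof. by rewrite dotC dot0l. Qed.

Lemma dot_sumr (I : Type) (r : seq I) (P : pred I) (X : I -> 'rV[R]_d) u :
  dot u (\sum_(i <- r | P i) X i) = \sum_(i <- r | P i) dot u (X i).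
Proof.
by elim/big_rec2: _ => [|i x y _ <-]; rewrite ?dot0r ?dotDr.
Qed.

Lemma enorm_ge0 u : 0 <= enorm u.
Proof. exact: sqrtr_ge0. Qed.

Lemma enorm_sqr u : enorm u ^+ 2 = dot u u.
Proof.
rewrite sqr_sqrtr; last by apply: sumr_ge0 => j _; rewrite sqr_ge0.
by apply: eq_bigr => j _; rewrite expr2.
Qed.

Lemma enorm0 : enorm (0 : 'rV[R]_d) = 0.
Proof. by apply/eqP; rewrite -sqrf_eq0 enorm_sqr dot0l. Qed.

Lemma enorm_eq0 u : enorm u = 0 -> u = 0.
Proof.
move=> u0; have: dot u u = 0 by rewrite -enorm_sqr u0 expr0n.
move/eqP; rewrite psumr_eq0; last by move=> j _; rewrite -expr2 sqr_ge0.
move=> /allP uu; apply/rowP => j; rewrite mxE.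
by have := uu j (mem_index_enum _); rewrite /= -expr2 sqrf_eq0 => /eqP.
Qed.

Lemma enormZ a u : enorm (a *: u) = `|a| * enorm u.
Proof.
apply/eqP; rewrite -(@eqrXn2 _ 2)// ?enorm_ge0 ?mulr_ge0 ?enorm_ge0//.
by rewrite exprMn !enorm_sqr dotZl dotZr mulrA real_normK ?num_real.
Qed.

Lemma enormN u : enorm (- u) = enorm u.
Proof. by rewrite -scaleN1r enormZ normrN1 mul1r. Qed.

Lemma enormC u v : enorm (u - v) = enorm (v - u).
Proof. by rewrite -enormN opprB. Qed.

(** The squared norm of [enorm v *: u - enorm u *: v] is twice [enorm u * enorm v] times the gap in
    the inequality. *)
Lemma cauchy_schwarz u v : dot u v <= enorm u * enorm v.
Proof.
have [u0|u0] := eqVneq (enorm u) 0.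
  by rewrite (enorm_eq0 u0) dot0l enorm0 mul0r.
have [v0|v0] := eqVneq (enorm v) 0.
  by rewrite (enorm_eq0 v0) dot0r enorm0 mulr0.
have up : 0 < enorm u by rewrite lt_neqAle eq_sym u0 enorm_ge0.
have vp : 0 < enorm v by rewrite lt_neqAle eq_sym v0 enorm_ge0.
have := sqr_ge0 (enorm (enorm v *: u - enorm u *: v)).
rewrite enorm_sqr !(dotDl, dotDr, dotNl, dotNr, dotZl, dotZr) (dotC v u).
rewrite -!enorm_sqr.
move: (enorm u) (enorm v) up vp (dot u v) => x y xp yp z h.
have : 0 <= 2 * (x * y) * (x * y - z) by lra.
by rewrite pmulr_rge0 ?subr_ge0// !mulr_gt0.
Qed.

Lemma cauchy_schwarz_norm u v : `|dot u v| <= enorm u * enorm v.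
Proof.
by rewrite ler_norml cauchy_schwarz andbT lerNl -dotNl -(enormN u) cauchy_schwarz.
Qed.

Lemma enormD_sqr u v :
  enorm (u + v) ^+ 2 = enorm u ^+ 2 + 2 * dot u v + enorm v ^+ 2.
Proof. by rewrite !enorm_sqr dotDl !dotDr (dotC v u); ring. Qed.

Lemma enormB_sqr u v :
  enorm (u - v) ^+ 2 = enorm u ^+ 2 - 2 * dot u v + enorm v ^+ 2.
Proof. by rewrite enormD_sqr enormN dotNr mulrN. Qed.

Lemma enormD u v : enorm (u + v) <= enorm u + enorm v.
Proof.
rewrite -(@ler_pXn2r _ 2)// ?nnegrE ?addr_ge0 ?enorm_ge0//.
by rewrite enormD_sqr; have := cauchy_schwarz u v; lra.
Qed.

Lemma enormB u v : enorm (u - v) <= enorm u + enorm v.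
Proof. by rewrite -(enormN v) enormD. Qed.

Lemma enorm_sum (I : Type) (r : seq I) (P : pred I) (X : I -> 'rV[R]_d) :
  enorm (\sum_(i <- r | P i) X i) <= \sum_(i <- r | P i) enorm (X i).
Proof.
elim/big_rec2: _ => [|i x y _ h]; first by rewrite enorm0.
by rewrite (le_trans (enormD _ _))// lerD2l.
Qed.

Lemma coord_le_enorm u j : `|u 0 j| <= enorm u.
Proof.
rewrite -sqrtr_sqr ler_wsqrtr// (bigD1 j)//= lerDl sumr_ge0// => i _.
exact: sqr_ge0.
Qed.

(** Duality: a vector is controlled by its scalar products, so the scalar mean value theorem can
    serve for gradients. *)
Lemma enorm_le_of_dot u a : 0 <= a ->
  (forall v, dot u v <= a * enorm v) -> enorm u <= a.
Proof.
move=> a0 /(_ u); rewrite -enorm_sqr expr2.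
have [->//|u0] := eqVneq (enorm u) 0.
by rewrite ler_pM2r// lt_neqAle eq_sym u0 enorm_ge0.
Qed.

(** Needed because the [sup] in [opnorm] is an upper bound only for a bounded set. *)
Lemma enorm_mul_bounded (A : 'M[R]_d) :
  has_ubound [set enorm (u *m A) | u in [set u : 'rV[R]_d | enorm u <= 1]].
Proof.
exists (\sum_(j < d) enorm (row j A)) => _ [u /= u1 <-].
rewrite mulmx_sum_row (le_trans (enorm_sum _ _ _))// ler_sum// => j _.
rewrite enormZ ler_piMl ?enorm_ge0//.
exact: le_trans (coord_le_enorm u j) u1.
Qed.

Lemma enorm_mul_le (A : 'M[R]_d) u : enorm (u *m A) <= opnorm A * enorm u.
Proof.
have [u0|u0] := eqVneq (enorm u) 0.
  by rewrite u0 (enorm_eq0 u0) mul0mx enorm0 mulr0.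
have up : 0 < enorm u by rewrite lt_neqAle eq_sym u0 enorm_ge0.
rewrite -ler_pdivrMr//.
apply: sup_upper_bound.
  split; last exact: enorm_mul_bounded.
  by exists (enorm ((0 : 'rV_d) *m A)), 0; rewrite //= enorm0 ler01.
exists ((enorm u)^-1 *: u) => /=.
  by rewrite enormZ ger0_norm ?invr_ge0 ?enorm_ge0// mulVf.
by rewrite -scalemxAl enormZ ger0_norm ?invr_ge0 ?enorm_ge0// mulrC.
Qed.

End EuclideanSpace.

(** * Gradients along lines *)

Section Calculus.
Context {R : realType} {d : nat}.
Implicit Types (x y u v w : 'rV[R]_d).

Lemma derive_dot_grad (f : 'rV[R]_d -> R) x w :
  differentiable f x -> 'D_w f x = dot (grad f x) w.
Proof.
move=> df; rewrite deriveE// [in LHS](row_sum_delta w) linear_sum.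
apply: eq_bigr => j _; rewrite linearZ/= mxE deriveE// mulrC; congr (_ * _).
Qed.

Lemma is_derive_dot_grad (f : 'rV[R]_d -> R) x w :
  differentiable f x -> is_derive x w f (dot (grad f x) w).
Proof.
by move=> df; rewrite -derive_dot_grad//; apply: derivableP; exact: diff_derivable.
Qed.

Lemma is_derive_dot_jacobian (g : 'rV[R]_d -> 'rV[R]_d) x w v :
  differentiable g x ->
  is_derive x w (fun y => dot (g y) v) (dot (w *m jacobian g x) v).
Proof.
move=> dg; rewrite -deriveEjacobian//.
have gw := @diff_derivable _ _ _ _ _ w dg.
have -> : (fun y => dot (g y) v) = \sum_(j < d) (fun y => v 0 j * g y 0 j).
  by apply/funext => y; rewrite fct_sumE; apply: eq_bigr => j _; rewrite mulrC.
rewrite /dot; apply: is_derive_sum => j.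
rewrite mulrC derive_mx// mxE.
by apply: is_deriveZ; apply: derivableP; move/derivable_mxP : gw.
Qed.

Lemma is_derive_line (f : 'rV[R]_d -> R) x w (t df : R) :
  is_derive (x + t *: w) w f df -> is_derive t 1 (fun s => f (x + s *: w)) df.
Proof.
have E : (fun h : R => h^-1 *: (f (h *: w + (x + t *: w)) - f (x + t *: w))) =
    (fun h : R => h^-1 *: (f (x + (h *: 1 + t) *: w) - f (x + t *: w))).
  by apply/funext => h; rewrite scalerDl scaler1 addrCA.
case=> D e; apply: DeriveDef; first by move: D; rewrite /derivable E.
by move: e; rewrite /derive E.
Qed.

Lemma mean_value_line (f df : 'rV[R]_d -> R) x w (t : R) : 0 <= t ->
  (forall p, is_derive p w f (df p)) ->
  exists2 c, 0 <= c <= t & f (x + t *: w) - f x = t * df (x + c *: w).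
Proof.
move=> t0 fdf.
have D (s : R) : is_derive s (1 : R) (fun s => f (x + s *: w)) (df (x + s *: w)).
  exact: is_derive_line.
have [|c c0t e] := MVT_segment t0 (fun s _ => D s).
  apply: continuous_subspaceT => s; apply: differentiable_continuous.
  by apply/derivable1_diffP; case: (D s).
exists c; first by move: c0t; rewrite in_itv.
by rewrite mulrC -[t in RHS]subr0 -e scale0r addr0.
Qed.

Section Smooth.
Variables (L : R) (f : 'rV[R]_d -> R).
Hypotheses (L0 : 0 <= L) (fL : lipschitz_gradient L f).

(** The mean value theorem gives the gradient at an intermediate point, hence [L] where integration
    would give [L / 2]. Only the order [t ^+ 2] matters below. *)
Lemma lipschitz_grad_line x w (t : R) : 0 <= t ->
  `|f (x + t *: w) - f x - t * dot (grad f x) w| <= L * t ^+ 2 * enorm w ^+ 2.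
Proof.
move=> t0; have [fd gL] := fL.
have [c /andP[c0 ct] ->] :=
  mean_value_line x t0 (fun p => is_derive_dot_grad w (fd p)).
rewrite -mulrBr -dotNl -dotDl normrM ger0_norm// [L * _]mulrC expr2 -!mulrA.
apply: ler_wpM2l => //; apply: (le_trans (cauchy_schwarz_norm _ _)).
rewrite expr2 !mulrA; apply: ler_wpM2r; first exact: enorm_ge0.
apply: (le_trans (gL _ _)); rewrite addrAC subrr add0r enormZ ger0_norm// -mulrA mulrCA.
by rewrite ler_wpM2r// mulr_ge0// enorm_ge0.
Qed.

End Smooth.

Lemma le_of_le_linear (a b c : R) : 0 <= c ->
  (forall t, 0 < t -> t < 1 -> a <= b + c * t) -> a <= b.
Proof.
move=> c0 h; apply/ler_addgt0Pr => e e0.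
(* This [t] lies in the open unit interval and satisfies [c * t <= e]. *)
have ec : 0 < e / (e + c + 1) < 1.
  by rewrite divr_gt0 ?ltr_pdivrMr /=; lra.
have /andP[t0 t1] := ec.
apply: (le_trans (h _ t0 t1)); rewrite lerD2l mulrA ler_pdivrMr; last lra.
nra.
Qed.

Section StronglyConvex.
Variables (L mu : R) (f : 'rV[R]_d -> R).
Hypotheses (L0 : 0 <= L) (mu0 : 0 <= mu).
Hypotheses (fL : lipschitz_gradient L f) (fmu : strongly_convex mu f).

(** Strong convexity on the segment from [x] to [y], divided by [t]; the smoothness error is then
    linear in [t] and vanishes as [t] tends to 0. *)
Lemma strongly_convex_grad x y :
  dot (grad f x) (y - x) <= f y - f x - mu / 2 * enorm (y - x) ^+ 2.
Proof.
apply: (@le_of_le_linear _ _ ((L + mu / 2) * enorm (y - x) ^+ 2)).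
  by rewrite mulr_ge0 ?sqr_ge0 ?addr_ge0 ?divr_ge0.
move=> t t0 t1.
have t01 : 0 <= t <= 1 by rewrite !ltW.
have := fmu y x t01.
have -> : t *: y + (1 - t) *: x = x + t *: (y - x).
  by rewrite scalerBl scalerBr scale1r addrCA addrA.
have := lipschitz_grad_line L0 fL x (y - x) (ltW t0).
rewrite ler_norml => /andP[h1 _] h2.
by rewrite -(ler_pM2l t0); lra.
Qed.

Lemma strong_monotone x y :
  mu * enorm (x - y) ^+ 2 <= dot (grad f x - grad f y) (x - y).
Proof.
have := strongly_convex_grad x y; have := strongly_convex_grad y x.
rewrite (enormC y x) -[y - x]opprB dotNr dotDl dotNl.
lra.
Qed.

End StronglyConvex.

Lemma holder_grad_taylor (rho nu : R) (f : 'rV[R]_d -> R) x w :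
  0 < nu -> 0 <= rho -> holder_hessian rho nu f ->
  enorm (grad f (x + w) - grad f x - w *m hess f x) <= rho * enorm w `^ (1 + nu).
Proof.
move=> nu0 rho0 [_ dg H].
apply: enorm_le_of_dot; first by rewrite mulr_ge0 ?powR_ge0.
move=> v.
have [c /andP[c0 c1]] := mean_value_line x (@ler01 R)
  (fun p => is_derive_dot_jacobian w v (dg p)).
rewrite scale1r mul1r => e.
rewrite !dotDl !dotNl e -dotNl -dotDl -mulmxBr.
apply: (le_trans (cauchy_schwarz _ _)); apply: ler_wpM2r; first exact: enorm_ge0.
apply: (le_trans (enorm_mul_le _ _)).
rewrite [1 + nu]addrC powRD; last first.
  by apply/implyP => /eqP; lra.
rewrite powRr1 ?enorm_ge0// mulrA; apply: ler_wpM2r; first exact: enorm_ge0.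
apply: (le_trans (H _ _)); apply: ler_wpM2l => //.
rewrite ge0_ler_powR ?nnegrE ?enorm_ge0 ?(ltW nu0)//.
by rewrite addrAC subrr add0r enormZ ger0_norm// ler_piMl ?enorm_ge0.
Qed.

End Calculus.

(** * The proximal step *)

Section MeanFunction.
Context {R : realType} {d n : nat}.
Variables (L : R) (f : 'I_n -> 'rV[R]_d -> R).
Hypothesis fL : forall i, lipschitz_gradient L (f i).

Lemma mean_funE : mean_fun f = n%:R^-1 *: \sum_(i < n) f i.
Proof. by apply/funext => x; rewrite /mean_fun [in RHS]fct_sumE. Qed.

Lemma grad_mean_fun x : grad (mean_fun f) x = n%:R^-1 *: \sum_(i < n) grad (f i) x.
Proof.
apply/rowP => j; rewrite !mxE mean_funE summxE.
have D i : derivable (f i) x (delta_mx 0 j).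
  by apply: diff_derivable; case: (fL i).
rewrite deriveZ; last exact: derivable_sum.
by rewrite derive_sum//; congr (_ *: _); apply: eq_bigr => i _; rewrite mxE.
Qed.

Lemma lipschitz_gradient_mean : (0 < n)%N -> lipschitz_gradient L (mean_fun f).
Proof.
move=> n0; split=> [x|u v].
  rewrite mean_funE; apply: differentiableZ; apply: differentiable_sum => i.
  by case: (fL i).
rewrite !grad_mean_fun -scalerBr -sumrB enormZ ger0_norm ?invr_ge0//.
rewrite ler_pdivrMl ?ltr0n//; apply: (le_trans (enorm_sum _ _ _)).
apply: (@le_trans _ _ (\sum_(i < n) L * enorm (u - v))).
  by apply: ler_sum => i _; case: (fL i).
by rewrite sumr_const card_ord -[leLHS]mulr_natl.
Qed.

End MeanFunction.

Section Prox.
Context {R : realType} {d : nat}.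
Implicit Types (x u v w z : 'rV[R]_d) (psi : 'rV[R]_d -> \bar R).

(** Compare [x] with [x + t *: (u - x)], bound [psi] by its chord, divide by [t] and let [t] tend to
    0. It serves both for the minimizer of [F + psi] and for the proximal point. *)
Lemma first_order_argmin psi (phi : 'rV[R]_d -> R) (a C : R) x g u (c r : R) :
  convex_fun psi -> 0 <= a -> 0 <= C ->
  (forall t, 0 < t < 1 ->
     phi (x + t *: (u - x)) <= phi x + t * dot g (u - x) + C * t ^+ 2) ->
  (forall y, a%:E * psi x + (phi x)%:E <= a%:E * psi y + (phi y)%:E)%E ->
  psi x = c%:E -> psi u = r%:E ->
  dot g (x - u) <= a * (r - c).
Proof.
move=> cpsi a0 C0 hphi xmin xc ur.
apply: (le_of_le_linear C0) => t t0 t1.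
have t01 : 0 < t < 1 by rewrite t0.
have e : t *: u + (1 - t) *: x = x + t *: (u - x).
  by rewrite scalerBl scalerBr scale1r addrCA addrA.
have := cpsi u x t t01; rewrite xc ur e -!EFinM -EFinD => h1.
have {}h1 := lee_wpmul2l (_ : (0 <= a%:E)%E) h1.
have {}h1 := leeD2r (phi (x + t *: (u - x)))%:E (h1 (a0 : (0 <= a%:E)%E)).
have := le_trans (xmin (x + t *: (u - x))) h1.
rewrite xc -!EFinM -!EFinD lee_fin => h2.
rewrite -(ler_pM2l t0) -[x - u]opprB dotNr; have := hphi t t01; lra.
Qed.

Lemma quadratic_expansion z x w (t : R) :
  2^-1 * enorm (x + t *: w - z) ^+ 2 =
  2^-1 * enorm (x - z) ^+ 2 + t * dot (x - z) w + 2^-1 * enorm w ^+ 2 * t ^+ 2.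
Proof.
rewrite [x + _ - z]addrAC (enormD_sqr (x - z)) dotZr enormZ exprMn.
by rewrite real_normK ?num_real//; lra.
Qed.

(** * Existence of the proximal point *)

Section Existence.
Variables (psi : 'rV[R]_d -> \bar R) (tau : R) (x0 g z : 'rV[R]_d) (c : R).
Hypotheses (tau0 : 0 < tau) (psip : proper_fun psi) (psic : closed_fun psi).
Hypothesis psi0 : psi x0 = c%:E.
Hypothesis psi_ge : forall u, ((c + dot g (u - x0))%:E <= psi u)%E.

(** Minimizing over pairs in the epigraph of [psi] makes the objective continuous and real valued,
    although [psi] may jump or be infinite. *)
Let Q (p : 'rV[R]_d * R) : R := tau * p.2 + 2^-1 * enorm (p.1 - z) ^+ 2.

Let Q_continuous : continuous Q.
Proof.
rewrite /Q => p; apply: cvgD.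
  by apply: cvgM; [exact: cvg_cst|exact: cvg_snd].
apply: cvgM; first exact: cvg_cst.
under eq_cvg do rewrite enorm_sqr.
rewrite enorm_sqr.
apply: cvg_big => [|j _]; first exact: add_continuous.
have h : (x : 'rV[R]_d * R).1 0 j @[x --> p] --> p.1 0 j.
  apply: (@continuous_comp _ _ _ fst (fun u : 'rV[R]_d => u 0 j)).
    exact: cvg_fst.
  exact: coord_continuous.
have h' : ((x : 'rV[R]_d * R).1 - z) 0 j @[x --> p] --> (p.1 - z) 0 j.
  under eq_cvg do rewrite mxE.
  by rewrite mxE; apply: cvgD => //; exact: cvg_cst.
exact: cvgM.
Qed.

Let K := [set p | (psi p.1 <= p.2%:E)%E] `&` [set p | Q p <= Q (x0, c)].

(** The affine minorant lets [psi] decrease at most linearly, so the quadratic term bounds [u]; the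
    minorant then bounds the height from below and [Q] bounds it from above. *)
Let K_bounded : exists M a b, forall p, K p ->
  (forall j, `|p.1 0 j| <= M) /\ a <= p.2 <= b.
Proof.
pose B := Q (x0, c) - tau * c - tau * dot g (z - x0).
(* For [y = enorm (u - z)] the constraint reads [y ^+ 2 / 2 <= B + tau * enorm g * y], which fails
   once [y > N]; the summand 1 ensures [y >= 1] there. *)
pose N := 2 * (tau * enorm g) + `|2 * B| + 1.
exists (enorm z + N), (c - enorm g * (N + enorm (z - x0))), (Q (x0, c) / tau).
case=> u t [/= h1 h2].
have h3 : c + dot g (u - x0) <= t by rewrite -lee_fin (le_trans (psi_ge u)).
have e : dot g (u - x0) = dot g (u - z) + dot g (z - x0).
  by rewrite -dotDr addrA subrK.
have h4 : 2^-1 * enorm (u - z) ^+ 2 <= B + tau * enorm g * enorm (u - z).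
  have := h2; rewrite /B {1}/Q /= => h2'.
  have := ler_wpM2l (ltW tau0) h3.
  have := ler_wpM2l (ltW tau0) (cauchy_schwarz_norm g (u - z)).
  have := ler_norm (- dot g (u - z)); rewrite normrN.
  move/(ler_wpM2l (ltW tau0)); rewrite e; lra.
have h5 : enorm (u - z) <= N.
  rewrite leNgt; apply/negP => h.
  have h6 := ler_norm (2 * B).
  have h7 := normr_ge0 (2 * B).
  have h8 : 0 <= tau * enorm g by rewrite mulr_ge0 ?enorm_ge0 ?ltW.
  have h9 : 1 <= enorm (u - z) by rewrite /N in h; lra.
  have : (enorm (u - z)) ^+ 2 > N * enorm (u - z).
    by rewrite expr2 ltr_pM2r//; lra.
  rewrite /N in h *; move: h4 h6 h7 h8 h9.
  move: (enorm (u - z)) (tau * enorm g) (`|2 * B|) => y G N' *.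
  have : N' <= N' * y by rewrite ler_peMr.
  lra.
split=> [j|].
  apply: (le_trans (coord_le_enorm u j)).
  rewrite -{1}[u](subrK z) addrC (le_trans (enormD _ _))// lerD2l//.
apply/andP; split.
  apply: le_trans h3; rewrite lerD2l lerNl -dotNr.
  apply: (le_trans (cauchy_schwarz _ _)); rewrite ler_wpM2l ?enorm_ge0//.
  rewrite enormN -[u](subrK z) -addrA (le_trans (enormD _ _))// lerD2r.
  by rewrite ?addrA ?addrK ?subrK.
rewrite ler_pdivlMr// mulrC; apply: le_trans h2; rewrite lerDl.
by rewrite mulr_ge0 ?invr_ge0 ?sqr_ge0.
Qed.

Let K_compact : compact K.
Proof.
have [M [a [b h]]] := K_bounded.
apply: (@subclosed_compact _ _
  ([set u : 'rV[R]_d | forall j, `[- M, M]%classic (u ord0 j)] `*` `[a, b]%classic)).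
- apply: closedI; first exact: psic.
  apply: (@preimage_closed _ _ Q [set y | y <= Q (x0, c)]).
    by move=> p _; exact: Q_continuous.
  exact: closed_le.
- apply: compact_setX; last exact: segment_compact.
  by apply: (@rV_compact R d (fun=> `[- M, M]%classic)) => j; exact: segment_compact.
- move=> p /h[h1 h2]; split => /=; last by rewrite in_itv.
  by move=> j; rewrite in_itv/= -ler_norml.
Qed.

(** The set from which [prox] picks is nonempty: a minimizer of [Q] on the compact set [K] projects
    to one of the proximal objective. *)
Lemma prox_argmin : argmin
  (fun u => (tau%:E * psi u + (2^-1 * enorm (u - z) ^+ 2)%R%:E)%E)
  (prox tau psi z).
Proof.
apply: getPex.
have Kx0 : K (x0, c) by split => /=; rewrite ?psi0.
have [[p t]] := compact_EVT_min (ex_intro _ _ Kx0) K_compact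
  (@continuous_subspaceT _ _ K _ Q_continuous).
move=> /[!inE] => -[/= ht hQ] pmin; exists p => u.
have [u_gt _] := psip.
apply: (@le_trans _ _ (Q (p, t))%:E).
  rewrite /Q EFinD (EFinM tau); apply: leeD2r; apply: lee_wpmul2l => //.
  by rewrite lee_fin ltW.
case E : (psi u) => [r| |]; last by have := u_gt u; rewrite E.
  rewrite -EFinM -EFinD lee_fin -[leRHS]/(Q (u, r)).
  (* A pair above the level of [(x0, c)] is outside [K], but its value already exceeds the
     minimum. *)
  have [hl|/ltW hl] := leP (Q (u, r)) (Q (x0, c)).
    by apply: pmin; rewrite inE; split; rewrite //= E.
  exact: le_trans hQ hl.
by rewrite gt0_muley ?lte_fin// addye// leey.
Qed.

End Existence.

(** By optimality [xs] is the proximal point of [xs - tau *: grad F xs], and the proximal map is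
    nonexpansive: add the first-order conditions at the two points and apply Cauchy-Schwarz. *)
Lemma prox_contraction (L tau : R) psi (F : 'rV[R]_d -> R) xs z :
  0 <= L -> 0 < tau -> lipschitz_gradient L F ->
  proper_fun psi -> closed_fun psi -> convex_fun psi ->
  argmin (fun x => ((F x)%:E + psi x)%E) xs ->
  enorm (prox tau psi z - xs) <= enorm (z - xs + tau *: grad F xs).
Proof.
move=> L0 tau0 FL psip psic psix xsmin.
have [psi_gt [y ypsi]] := psip.
have finite u : (psi u < +oo)%E -> exists r : R, psi u = r%:E.
  by case E : (psi u) (psi_gt u) => [r| |]// _ _; exists r.
have [r0 yr] := finite y ypsi.
have [c xsc] : exists c : R, psi xs = c%:E.
  apply: finite; have := xsmin y; rewrite yr -EFinD.
  by case: (psi xs) => [s| |]; rewrite ?ltry// addey// leye_eq.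
have xsmin1 v : (1%:E * psi xs + (F xs)%:E <= 1%:E * psi v + (F v)%:E)%E.
  by rewrite !mul1e ![(_ + _%:E)%E]addeC; exact: xsmin.
have Fexp u t : 0 < t < 1 -> F (xs + t *: (u - xs)) <=
    F xs + t * dot (grad F xs) (u - xs) + L * enorm (u - xs) ^+ 2 * t ^+ 2.
  case/andP=> t0 _; have := lipschitz_grad_line L0 FL xs (u - xs) (ltW t0).
  by rewrite ler_norml => /andP[_]; lra.
have sub u r : psi u = r%:E -> dot (grad F xs) (xs - u) <= r - c.
  move=> ur; rewrite -[leRHS]mul1r.
  apply: (first_order_argmin psix ler01 _ (Fexp u) xsmin1 xsc ur).
  by rewrite mulr_ge0 ?sqr_ge0.
(* The subgradient [- grad F xs] at the minimizer supplies the affine minorant for the existence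
   proof, without a separation theorem. *)
have psi_ge u : ((c + dot (- grad F xs) (u - xs))%:E <= psi u)%E.
  case E : (psi u) => [r| |]; rewrite ?leey//; last by have := psi_gt u; rewrite E.
  by rewrite lee_fin dotNl -dotNr opprB; have := sub _ _ E; lra.
have pmin := prox_argmin z tau0 psip psic xsc psi_ge.
move: (prox tau psi z) pmin => p pmin.
have [r pr] : exists r : R, psi p = r%:E.
  apply: finite; have /= := pmin xs; rewrite xsc -EFinM -EFinD.
  by case: (psi p) => [s| |]; rewrite ?ltry// gt0_muley ?lte_fin// addye// leye_eq.
have h1 : dot (p - z) (p - xs) <= tau * (c - r).
  apply: (first_order_argmin psix (ltW tau0) _ _ pmin pr xsc); last first.
    by move=> t _; rewrite quadratic_expansion.
  by rewrite mulr_ge0 ?sqr_ge0 ?invr_ge0.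
have h2 := ler_wpM2l (ltW tau0) (sub _ _ pr).
have h3 : enorm (p - xs) ^+ 2 <= dot (z - xs + tau *: grad F xs) (p - xs).
  have -> : z - xs + tau *: grad F xs = (p - xs) - (p - z) + tau *: grad F xs.
    by congr (_ + _); rewrite opprB [RHS]addrC addrA subrK.
  move: h1 h2; rewrite enorm_sqr -[xs - p]opprB !dotDl !dotNr !dotNl dotZl.
  rewrite !dotDl !dotNl; lra.
have := le_trans h3 (cauchy_schwarz _ _); rewrite expr2.
have [->|p0] := eqVneq (enorm (p - xs)) 0; first by rewrite enorm_ge0.
by rewrite ler_pM2r// lt_neqAle eq_sym p0 enorm_ge0.
Qed.

End Prox.

(** * Sampling without replacement *)

Section PermutationSums.
Context {R : realType} {d n : nat}.
Implicit Types (s : 'S_n) (v : 'I_n -> 'rV[R]_d).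

Definition prefix_sum v s (i : nat) : 'rV[R]_d :=
  \sum_(j < n | (j < i)%N) v (s j).

Lemma prefix_sum0 v s : prefix_sum v s 0 = 0.
Proof. by rewrite /prefix_sum big_pred0. Qed.

Lemma prefix_sumS v s (i : 'I_n) :
  prefix_sum v s i.+1 = prefix_sum v s i + v (s i).
Proof.
rewrite /prefix_sum (bigD1 i)//= addrC; congr (_ + _).
apply: eq_bigl => j; rewrite ltnS leq_eqVlt -(inj_eq val_inj) /=.
by case: ltngtP.
Qed.

(** Permutations compose from left to right, so [tperm i l * s] exchanges the entries of [s] at
    positions [i] and [l]. *)
Lemma sum_perm_tperm (V : nmodType) (X : 'S_n -> V) (i l : 'I_n) :
  \sum_(s : 'S_n) X s = \sum_(s : 'S_n) X (tperm i l * s)%g.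
Proof. exact: (reindex_inj (mulgI (tperm i l))). Qed.

Lemma prefix_sum_tperm v s (i l : 'I_n) : (i <= l)%N ->
  prefix_sum v (tperm i l * s)%g i = prefix_sum v s i.
Proof.
move=> il; apply: eq_bigr => j ji; rewrite permM tpermD//.
  by apply: contraTneq ji => <-; rewrite ltnn.
by apply: contraTneq ji => <-; rewrite -leqNgt.
Qed.

(** If [l < i], the exchange replaces [v (s l)] by [v (s i)] in the prefix; otherwise the prefix is
    unchanged. *)
Lemma prefix_sum_tperm_le v s (i l : 'I_n) (B : R) :
  (forall m m', enorm (v m - v m') <= B) ->
  enorm (prefix_sum v (tperm i l * s)%g i - prefix_sum v s i) <= B.
Proof.
move=> vB; have [il|li] := leqP i l.
  by rewrite prefix_sum_tperm// subrr enorm0 (le_trans (enorm_ge0 _) (vB l l)).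
rewrite /prefix_sum !(bigD1 (P := fun j : 'I_n => (j < i)%N) l)//= permM tpermR.
rewrite opprD addrACA -sumrB big1 ?addr0//= => j /andP[ji jl].
rewrite permM tpermD ?subrr// 1?eq_sym//.
by apply: contraTneq ji => <-; rewrite ltnn.
Qed.

(** Undoing the exchange turns the index [s i] into [s l] and restores the prefix; as [l] varies,
    [s l] runs over all indices. *)
Lemma sum_perm_swap (V : nmodType) (g : 'I_n -> 'rV[R]_d -> V) v (i : 'I_n) :
  \sum_(s : 'S_n) \sum_(m < n) g m (prefix_sum v s i) =
  \sum_(l < n) \sum_(s : 'S_n) g (s i) (prefix_sum v (tperm i l * s)%g i).
Proof.
rewrite [RHS](eq_bigr (fun l => \sum_(s : 'S_n) g (s l) (prefix_sum v s i))).
  rewrite [RHS]exchange_big; apply: eq_bigr => s _.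
  exact: (reindex_inj (@perm_inj _ s)).
move=> l _; rewrite [RHS](sum_perm_tperm _ i l).
by apply: eq_bigr => s _; rewrite permM tpermR.
Qed.

(* Pairing [s] with [tperm i l * s] decouples the index [s i] from the prefix
   drawn before it, at the price of changing at most one term of the prefix. *)
Lemma without_replacement_bias (g : 'I_n -> 'rV[R]_d -> 'rV[R]_d) v (i : 'I_n)
    (Lg B : R) : 0 <= Lg ->
  (forall m x y, enorm (g m x - g m y) <= Lg * enorm (x - y)) ->
  (forall m m', enorm (v m - v m') <= B) ->
  enorm (\sum_(s : 'S_n) g (s i) (prefix_sum v s i) -
         n%:R^-1 *: \sum_(s : 'S_n) \sum_(m < n) g m (prefix_sum v s i)) <=
  #|{: 'S_n}|%:R * (Lg * B).
Proof.
move=> Lg0 gL vB.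
have n0 : (0 < n)%N by case: n i => // -[].
have -> : \sum_(s : 'S_n) g (s i) (prefix_sum v s i) =
    n%:R^-1 *: \sum_(l < n) \sum_(s : 'S_n) g (s i) (prefix_sum v s i).
  rewrite sumr_const card_ord -[X in _ *: X]scaler_nat scalerA.
  by rewrite mulVf ?scale1r// pnatr_eq0 -lt0n.
rewrite sum_perm_swap -scalerBr -sumrB enormZ ger0_norm ?invr_ge0//.
rewrite ler_pdivrMl ?ltr0n//; apply: (le_trans (enorm_sum _ _ _)).
apply: (@le_trans _ _ (\sum_(l < n) #|{: 'S_n}|%:R * (Lg * B))); last first.
  by rewrite sumr_const card_ord [leRHS]mulr_natl.
apply: ler_sum => l _.
rewrite -sumrB (le_trans (enorm_sum _ _ _))// mulr_natl -sumr_const ler_sum// => s _.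
rewrite (le_trans (gL _ _ _))// ler_wpM2l// enormC.
exact: prefix_sum_tperm_le.
Qed.

(** Each single entry of a uniform permutation is uniform. *)
Lemma sum_perm_term (V : lmodType R) (g : 'I_n -> V) (i : 'I_n) :
  n%:R *: \sum_(s : 'S_n) g (s i) = \sum_(s : 'S_n) \sum_(m < n) g m.
Proof.
have -> : n%:R *: \sum_(s : 'S_n) g (s i) = \sum_(l < n) \sum_(s : 'S_n) g (s l).
  transitivity (\sum_(l < n) \sum_(s : 'S_n) g (s i)).
    by rewrite sumr_const card_ord scaler_nat.
  apply: eq_bigr => l _.
  by rewrite (sum_perm_tperm _ i l); apply: eq_bigr => s _; rewrite permM tpermL.
rewrite [LHS]exchange_big; apply: eq_bigr => s _.
by rewrite [RHS](reindex_inj (@perm_inj _ s)).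
Qed.

Lemma sum_perm_prefix_sum0 v i : \sum_(m < n) v m = 0 ->
  \sum_(s : 'S_n) prefix_sum v s i = 0.
Proof.
move=> v0; rewrite exchange_big big1//= => j _.
have n0 : n%:R != 0 :> R by rewrite pnatr_eq0; case: n j => // -[].
have /eqP : n%:R *: \sum_(s : 'S_n) v (s j) = 0.
  by rewrite sum_perm_term v0; apply: big1.
by rewrite scaler_eq0 (negPf n0) => /eqP.
Qed.

(* The increments are negatively correlated: the terms not yet drawn sum to
   minus the current prefix, and are exchangeable. *)
Lemma prefix_sum_cross_le0 v (i : 'I_n) : \sum_(m < n) v m = 0 ->
  \sum_(s : 'S_n) dot (prefix_sum v s i) (v (s i)) <= 0.
Proof.
move=> v0.
have cross (l : 'I_n) : (i <= l)%N -> \sum_(s : 'S_n) dot (prefix_sum v s i) (v (s l)) =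
    \sum_(s : 'S_n) dot (prefix_sum v s i) (v (s i)).
  move=> il; rewrite (sum_perm_tperm _ i l); apply: eq_bigr => s _.
  by rewrite prefix_sum_tperm// permM tpermR.
have rest s : \sum_(l < n | (i <= l)%N) v (s l) = - prefix_sum v s i.
  apply/eqP; rewrite -addr_eq0 addrC /prefix_sum; apply/eqP.
  transitivity (\sum_(m < n) v m) => //; rewrite [RHS](reindex_inj (@perm_inj _ s)).
  rewrite [RHS](bigID (fun j : 'I_n => (j < i)%N))/=; congr (_ + _).
  by apply: eq_bigl => j; rewrite -leqNgt.
have : \sum_(l < n | (i <= l)%N) \sum_(s : 'S_n) dot (prefix_sum v s i) (v (s l)) <= 0.
  rewrite exchange_big /= sumr_le0// => s _.
  by rewrite -dot_sumr rest dotNr oppr_le0 -enorm_sqr sqr_ge0.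
rewrite (eq_bigr (fun=> \sum_(s : 'S_n) dot (prefix_sum v s i) (v (s i))))//.
rewrite sumr_const pmulrn_lle0//; apply/card_gt0P; exists i.
exact: leqnn.
Qed.

(** Induction on [i]: the cross term of each new increment is nonpositive, so the variance grows no
    faster than under independent sampling. *)
Lemma prefix_sum_variance v (V : R) i : (i <= n)%N ->
  \sum_(m < n) v m = 0 -> (forall m, enorm (v m) ^+ 2 <= V) ->
  \sum_(s : 'S_n) enorm (prefix_sum v s i) ^+ 2 <= #|{: 'S_n}|%:R * (i%:R * V).
Proof.
move=> + v0 vV; elim: i => [_|i IH lin].
  rewrite mul0r mulr0; apply: sumr_le0 => s _.
  by rewrite prefix_sum0 enorm0 expr0n.
have h := prefix_sum_cross_le0 (Ordinal lin) v0.
rewrite (eq_bigr _ (fun s _ => congr1 (fun u => enorm u ^+ 2)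
  (prefix_sumS v s (Ordinal lin)))) /= in h *.
rewrite (eq_bigr _ (fun s _ => enormD_sqr _ _)) !big_split/= -mulr_sumr.
have h1 : \sum_(s : 'S_n) enorm (v (s (Ordinal lin))) ^+ 2 <= #|{: 'S_n}|%:R * V.
  by rewrite mulr_natl -sumr_const ler_sum.
have {IH}h2 := IH (ltnW lin).
rewrite -[i.+1%:R]natr1 (mulrDl i%:R) mul1r mulrDr lerD//.
rewrite -[leRHS]addr0 lerD// pmulr_rle0//.
Qed.

Lemma prefix_sum_norm_le v s i (B : R) : (i <= n)%N ->
  (forall m, enorm (v m) <= B) -> enorm (prefix_sum v s i) <= i%:R * B.
Proof.
move=> + vB; elim: i => [_|i IH lin]; first by rewrite prefix_sum0 enorm0 mul0r.
rewrite (prefix_sumS v s (Ordinal lin)) /= (le_trans (enormD _ _))//.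
by rewrite -[i.+1%:R]natr1 (mulrDl i%:R) mul1r lerD ?IH ?(ltnW lin).
Qed.

End PermutationSums.

(** * The error of one epoch *)

Section Averages.
Context {R : realType}.

(** Nonnegativity of the variance. *)
Lemma mean_sqr_le (T : finType) (X : T -> R) : (0 < #|T|)%N ->
  (#|T|%:R^-1 * \sum_t X t) ^+ 2 <= #|T|%:R^-1 * \sum_t X t ^+ 2.
Proof.
move=> T0; set m := _ * \sum_t X t.
have T1 : #|T|%:R != 0 :> R by rewrite pnatr_eq0 -lt0n.
have : 0 <= \sum_t (X t - m) ^+ 2 by apply: sumr_ge0 => t _; exact: sqr_ge0.
have -> : \sum_t (X t - m) ^+ 2 = \sum_t X t ^+ 2 - #|T|%:R * m ^+ 2.
  rewrite (eq_bigr (fun t => X t ^+ 2 + (- (2 * m) * X t + m ^+ 2))); last first.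
    by move=> t _; ring.
  rewrite 2!big_split/= -mulr_sumr sumr_const -[m ^+ 2 *+ _]mulr_natl.
  have -> : \sum_t X t = #|T|%:R * m by rewrite mulrA divff// mul1r.
  by congr (_ + _); ring.
by rewrite subr_ge0 ler_pdivlMl ?ltr0n.
Qed.

Lemma powR_le_quadratic (x a p : R) : 0 <= x -> 0 < a -> 0 <= p -> p <= 2 ->
  x `^ p <= a `^ p + a `^ p / a ^+ 2 * x ^+ 2.
Proof.
move=> x0 a0 p0 p2; have [xa|/ltW ax] := leP x a.
  apply: (@le_trans _ _ (a `^ p)); first by rewrite ge0_ler_powR ?nnegrE// ltW.
  by rewrite lerDl !mulr_ge0 ?invr_ge0 ?sqr_ge0 ?powR_ge0.
have xp : 0 < x by exact: lt_le_trans ax.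
rewrite -[leLHS]add0r lerD ?powR_ge0//.
rewrite mulrAC ler_pdivlMr ?exprn_gt0//.
have split2 b : 0 < b -> b ^+ 2 = b `^ p * b `^ (2 - p).
  move=> b0; rewrite -powRD; last by rewrite (gt_eqF b0) implybT.
  have -> : p + (2 - p) = 2%:R by lra.
  by rewrite powR_mulrn// ltW.
rewrite (split2 a)// (split2 x)// mulrCA; do 2!(apply: ler_wpM2l; first exact: powR_ge0).
by rewrite ge0_ler_powR ?nnegrE ?subr_ge0// ltW.
Qed.

Lemma mean_affine_le (T : finType) (X Y : T -> R) (c k B : R) : 0 <= k ->
  (forall t, Y t <= c + k * X t) -> \sum_t X t <= #|T|%:R * B ->
  \sum_t Y t <= #|T|%:R * (c + k * B).
Proof.
move=> k0 YX XB; apply: (@le_trans _ _ (\sum_t (c + k * X t))).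
  exact: ler_sum.
rewrite big_split/= sumr_const -mulr_sumr -[c *+ _]mulr_natl mulrDr lerD2l.
by rewrite mulrCA ler_wpM2l.
Qed.

End Averages.

Section Epoch.
Context {R : realType} {d n : nat}.
Variables (L eta : R) (f : 'I_n -> 'rV[R]_d -> R) (y : 'rV[R]_d).
Hypotheses (L0 : 0 <= L) (eta0 : 0 <= eta) (n0 : (0 < n)%N).
Hypothesis fL : forall i, lipschitz_gradient L (f i).
Let F := mean_fun f.
Let h := n%:R * eta.
Implicit Types (s : 'S_n) (i : nat).

Let n_neq0 : n%:R != 0 :> R. Proof. by rewrite pnatr_eq0 -lt0n. Qed.
Let n_gt0 : 0 < n%:R :> R. Proof. by rewrite ltr0n. Qed.

Definition inner s i : 'rV[R]_d :=
  foldl (fun x j => x - eta *: grad (f (s j)) x) y (take i (enum 'I_n)).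

Definition epoch_error s : 'rV[R]_d :=
  n%:R^-1 *: \sum_(j < n) (grad (f (s j)) (inner s j) - grad (f (s j)) y).

Definition drift s : R := n%:R^-1 * \sum_(j < n) enorm (inner s j - y).

Definition dev (m : 'I_n) : 'rV[R]_d := grad (f m) y - grad F y.

(** The [z_i] of the overview: gradients frozen at [y] and centred, so that the displacement has
    mean zero over permutations. *)
Definition shuffled_point s i : 'rV[R]_d := y - eta *: prefix_sum dev s i.

Definition shuffle_size s : R :=
  n%:R^-1 * \sum_(j < n) (eta * enorm (prefix_sum dev s j)).

Lemma innerS s (i : 'I_n) :
  inner s i.+1 = inner s i - eta *: grad (f (s i)) (inner s i).
Proof.
rewrite /inner (take_nth i) ?size_enum_ord// -cats1 foldl_cat /=.
by rewrite nth_ord_enum.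
Qed.

Lemma inner_prefix s i : (i <= n)%N ->
  inner s i = y - eta *: \sum_(j < n | (j < i)%N) grad (f (s j)) (inner s j).
Proof.
elim: i => [_|i IH lin].
  by rewrite big_pred0// scaler0 subr0 /inner take0.
rewrite (innerS s (Ordinal lin)) /= {1}(IH (ltnW lin)) -addrA; congr (_ + _).
rewrite -opprD -scalerDr; congr (- (_ *: _)).
rewrite [RHS](bigD1 (Ordinal lin))//= addrC; congr (_ + _).
apply: eq_bigl => j; apply/esym; rewrite ltnS leq_eqVlt -(inj_eq val_inj) /=.
by case: ltngtP.
Qed.

Lemma sum_grad x : \sum_(m < n) grad (f m) x = n%:R *: grad F x.
Proof. by rewrite (grad_mean_fun fL) scalerA divff// scale1r. Qed.

Lemma sum_dev : \sum_(m < n) dev m = 0.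
Proof. by rewrite sumrB sum_grad sumr_const card_ord scaler_nat subrr. Qed.

Lemma epochE s : epoch f eta s y = y - h *: (grad F y + epoch_error s).
Proof.
have -> : epoch f eta s y = inner s n.
  by rewrite /inner take_oversize ?size_enum_ord.
rewrite inner_prefix//; congr (_ - _).
rewrite /h [n%:R * _]mulrC -scalerA; congr (_ *: _).
rewrite scalerDr scalerA divff// scale1r -sum_grad.
rewrite [X in X + _](reindex_inj (@perm_inj _ s)) -big_split/=.
by apply: eq_big => j; rewrite ?ltn_ord// => _; rewrite addrC subrK.
Qed.

Lemma epoch_error_le s : enorm (epoch_error s) <= L * drift s.
Proof.
rewrite enormZ ger0_norm ?invr_ge0// mulrCA ler_wpM2l ?invr_ge0//.
rewrite (le_trans (enorm_sum _ _ _))// mulr_sumr ler_sum// => j _.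
by case: (fL (s j)).
Qed.

Lemma drift_ge0 s : 0 <= drift s.
Proof. by rewrite mulr_ge0 ?invr_ge0// sumr_ge0// => j _; exact: enorm_ge0. Qed.

Lemma shuffle_size_ge0 s : 0 <= shuffle_size s.
Proof.
rewrite mulr_ge0 ?invr_ge0// sumr_ge0// => j _.
by rewrite mulr_ge0 ?enorm_ge0.
Qed.

(** Two effects separate the points: the mean gradient removed by centring, and the evaluation of
    gradients at the inner iterates instead of [y]. *)
Lemma inner_shuffled_le s i : (i <= n)%N ->
  enorm (inner s i - shuffled_point s i) <=
  h * enorm (grad F y) + h * L * drift s.
Proof.
move=> lin; rewrite inner_prefix// /shuffled_point opprB addrC addrA subrK.
have -> : eta *: prefix_sum dev s i
    - eta *: \sum_(j < n | (j < i)%N) grad (f (s j)) (inner s j) =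
    - (eta *: (\sum_(j < n | (j < i)%N) grad F y +
       \sum_(j < n | (j < i)%N) (grad (f (s j)) (inner s j) - grad (f (s j)) y))).
  rewrite -scalerBr -scalerN; congr (_ *: _).
  rewrite /prefix_sum -sumrB -big_split -sumrN; apply: eq_bigr => j _.
  by rewrite /dev /= opprD opprB addrAC [RHS]addrC.
rewrite enormN enormZ ger0_norm// /h -!mulrA -!(mulrCA eta) -mulrDr.
apply: ler_wpM2l => //; apply: (le_trans (enormD _ _)); apply: lerD.
  apply: (le_trans (enorm_sum _ _ _)).
  apply: (@le_trans _ _ (\sum_(j < n) enorm (grad F y))).
    rewrite big_mkcond; apply: ler_sum => j _; case: ifP => // _.
    exact: enorm_ge0.
  by rewrite sumr_const card_ord [leRHS]mulr_natl.
rewrite /drift mulrA (mulrC _ L) -mulrA mulVKf//.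
apply: (le_trans (enorm_sum _ _ _)); rewrite mulr_sumr.
rewrite [leRHS](bigID (fun j : 'I_n => (j < i)%N))/= -[leLHS]addr0 lerD//.
  by apply: ler_sum => j _; case: (fL (s j)).
by apply: sumr_ge0 => j _; rewrite mulr_ge0 ?enorm_ge0.
Qed.

(** The drift reappears on the right with factor [h * L], at most one half, and is absorbed on the
    left. *)
Lemma drift_le s : h * L <= 2^-1 ->
  drift s <= 2 * (h * enorm (grad F y) + shuffle_size s).
Proof.
move=> hL.
have : drift s <= h * enorm (grad F y) + h * L * drift s + shuffle_size s.
  rewrite [leLHS]/drift ler_pdivrMl// mulrDr.
  have -> : n%:R * shuffle_size s = \sum_(j < n) (eta * enorm (prefix_sum dev s j)).
    by rewrite mulrA divff// mul1r.
  have -> : n%:R * (h * enorm (grad F y) + h * L * drift s) =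
      \sum_(j < n) (h * enorm (grad F y) + h * L * drift s).
    by rewrite sumr_const card_ord mulr_natl.
  rewrite -big_split/= ler_sum// => j _.
  have e : inner s j - y = (inner s j - shuffled_point s j) -
      eta *: prefix_sum dev s j.
    by rewrite /shuffled_point opprB addrA [RHS]addrAC addrK.
  rewrite e (le_trans (enormB _ _))// enormZ ger0_norm// lerD2r.
  by rewrite inner_shuffled_le// ltnW.
have := ler_wpM2r (drift_ge0 s) hL; have := drift_ge0 s.
by move: (drift s) (shuffle_size s) => D W; lra.
Qed.

End Epoch.

(** * Bias and second moment of the epoch error *)

Section EpochMoments.
Context {R : realType} {d n : nat}.
Variables (L eta sigma rho nu : R) (f : 'I_n -> 'rV[R]_d -> R) (y : 'rV[R]_d).
Hypotheses (L0 : 0 <= L) (eta0 : 0 < eta) (n0 : (0 < n)%N) (sigma0 : 0 < sigma).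
Hypotheses (rho0 : 0 <= rho) (nu0 : 0 < nu) (nu1 : nu <= 1).
Hypothesis fL : forall i, lipschitz_gradient L (f i).
Hypothesis hessF : holder_hessian rho nu (mean_fun f).
Hypothesis dev_le : forall m, enorm (dev f y m) <= sigma.
Let F := mean_fun f.
Let h := n%:R * eta.
Let g := enorm (grad F y).
Hypothesis hL : h * L <= 2^-1.
Let N : R := #|{: 'S_n}|%:R.
(** Root mean square scale of the displacement caused by shuffling. *)
Let a := eta * Num.sqrt n%:R * sigma.

Let n_neq0 : n%:R != 0 :> R. Proof. by rewrite pnatr_eq0 -lt0n. Qed.
Let n_gt0 : 0 < n%:R :> R. Proof. by rewrite ltr0n. Qed.
Let eta_ge0 : 0 <= eta. Proof. exact: ltW. Qed.
Let h_ge0 : 0 <= h. Proof. by rewrite mulr_ge0 ?ler0n. Qed.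
Let a_gt0 : 0 < a. Proof. by rewrite !mulr_gt0// sqrtr_gt0. Qed.
Let g_ge0 : 0 <= g. Proof. exact: enorm_ge0. Qed.
Let W (s : 'S_n) (i : nat) := prefix_sum (dev f y) s i.

Lemma shuffled_second_moment (i : nat) : (i <= n)%N ->
  \sum_(s : 'S_n) (eta * enorm (W s i)) ^+ 2 <= N * a ^+ 2.
Proof.
move=> lin.
have V m : enorm (dev f y m) ^+ 2 <= sigma ^+ 2.
  by rewrite ler_pXn2r ?nnegrE ?enorm_ge0// ltW.
have := prefix_sum_variance lin (sum_dev y n0 fL) V.
rewrite -(ler_pM2l (exprn_gt0 2 eta0)) => le1.
have -> : \sum_(s : 'S_n) (eta * enorm (W s i)) ^+ 2 =
    eta ^+ 2 * \sum_(s : 'S_n) enorm (W s i) ^+ 2.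
  by rewrite mulr_sumr; apply: eq_bigr => s _; rewrite exprMn.
apply: (le_trans le1); rewrite mulrCA ler_wpM2l ?ler0n//.
rewrite /a !exprMn sqr_sqrtr ?ler0n// -(mulrA (eta ^+ 2)) ler_wpM2l ?sqr_ge0//.
by rewrite ler_wpM2r ?sqr_ge0 ?ler_nat.
Qed.

Lemma shuffle_size_second_moment :
  \sum_(s : 'S_n) shuffle_size eta f y s ^+ 2 <= N * a ^+ 2.
Proof.
apply: (@le_trans _ _ (\sum_(s : 'S_n) n%:R^-1 *
    \sum_(j < n) (eta * enorm (W s j)) ^+ 2)).
  apply: ler_sum => s _.
  have := @mean_sqr_le _ 'I_n (fun j => eta * enorm (W s j)).
  by rewrite card_ord; exact.
rewrite -mulr_sumr exchange_big ler_pdivrMl//= mulr_natl.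
apply: (@le_trans _ _ (\sum_(j < n) N * a ^+ 2)).
  by apply: ler_sum => j _; rewrite shuffled_second_moment// ltnW.
by rewrite sumr_const card_ord.
Qed.

(** Balanced at [x = a], so passing from the second moment [a ^+ 2] to the first moment [a] loses
    nothing. *)
Let le_quad (x : R) : x <= a / 2 + (2 * a)^-1 * x ^+ 2.
Proof.
rewrite -subr_ge0.
have -> : a / 2 + (2 * a)^-1 * x ^+ 2 - x = (2 * a)^-1 * (x - a) ^+ 2.
  by field; rewrite gt_eqF.
by rewrite mulr_ge0 ?sqr_ge0// invr_ge0 mulr_ge0 ?ltW.
Qed.

Lemma shuffle_size_mean : \sum_(s : 'S_n) shuffle_size eta f y s <= N * a.
Proof.
have -> : a = a / 2 + (2 * a)^-1 * a ^+ 2 by field; rewrite gt_eqF.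
apply: (mean_affine_le _ _ shuffle_size_second_moment) => [|s].
  by rewrite invr_ge0 mulr_ge0 ?ltW.
exact: le_quad.
Qed.

Lemma shuffled_powR_mean (i : nat) : (i <= n)%N ->
  \sum_(s : 'S_n) (eta * enorm (W s i)) `^ (1 + nu) <= N * (2 * a `^ (1 + nu)).
Proof.
move=> lin.
have -> : 2 * a `^ (1 + nu) = a `^ (1 + nu) + a `^ (1 + nu) / a ^+ 2 * a ^+ 2.
  by field; rewrite gt_eqF.
apply: (mean_affine_le _ _ (shuffled_second_moment lin)) => [|s].
  by rewrite mulr_ge0 ?powR_ge0 ?invr_ge0 ?sqr_ge0.
apply: powR_le_quadratic => //; first by rewrite mulr_ge0 ?enorm_ge0.
- by rewrite addr_ge0 ?ltW.
- by move: nu1; lra.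
Qed.

Lemma epoch_error_second_moment :
  \sum_(s : 'S_n) enorm (epoch_error eta f y s) ^+ 2 <=
  N * (8 * L ^+ 2 * (h * g) ^+ 2 + 8 * L ^+ 2 * a ^+ 2).
Proof.
apply: (mean_affine_le _ _ shuffle_size_second_moment) => [|s].
  by rewrite mulr_ge0 ?sqr_ge0.
have le1 := epoch_error_le eta y fL s.
have le2 := drift_le y L0 eta_ge0 n0 fL s hL.
have := enorm_ge0 (epoch_error eta f y s).
rewrite -/F -/h -/g in le2 *.
have := shuffle_size_ge0 f y eta_ge0 s.
have := drift_ge0 eta f y s.
move: le1 le2.
move: (shuffle_size _ _ _ _) (drift _ _ _ _) (enorm _) => w D e le1 le2 D0 w0 e0.
have hg0 : 0 <= h * g by rewrite mulr_ge0.
move: le2 hg0; move: (h * g) => q le2 q0.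
have le3 : e <= L * (2 * (q + w)) by rewrite (le_trans le1)// ler_wpM2l.
have le4 : e ^+ 2 <= (L * (2 * (q + w))) ^+ 2.
  by rewrite ler_pXn2r ?nnegrE// mulr_ge0// mulr_ge0// addr_ge0.
apply: (le_trans le4).
have := mulr_ge0 (sqr_ge0 L) (sqr_ge0 (q - w)); lra.
Qed.

Let gm (m : 'I_n) (w : 'rV[R]_d) := grad (f m) (y - eta *: w) - grad (f m) y.

(** The decoupling replaces the component gradient by that of [F] and costs [L * eta * (2 * sigma)];
    the rest is the Hölder remainder, because the linear term averages to zero. *)
Lemma shuffled_grad_bias (i : 'I_n) :
  enorm (\sum_(s : 'S_n) gm (s i) (W s i)) <=
  N * (L * eta * (2 * sigma) + rho * (2 * a `^ (1 + nu))).
Proof.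
have gmL m u v : enorm (gm m u - gm m v) <= L * eta * enorm (u - v).
  rewrite /gm opprB addrA subrK; case: (fL m) => _ /(_ (y - eta *: u) (y - eta *: v)).
  rewrite [y - _ - _]addrC opprB addrA subrK -scalerBr enormZ ger0_norm//.
  by rewrite mulrA (enormC v).
have dB m m' : enorm (dev f y m - dev f y m') <= 2 * sigma.
  by rewrite (le_trans (enormB _ _))// mulr_natl mulr2n lerD.
have L_eta0 : 0 <= L * eta by rewrite mulr_ge0.
have := without_replacement_bias i L_eta0 gmL dB.
set X := \sum_(s : 'S_n) gm (s i) _; set Y := _ *: _ => XY.
rewrite -[X](subrK Y) mulrDr (le_trans (enormD _ _))// lerD//.
(* The Hessian term can be inserted freely: prefix sums of centred vectors sum to zero over
   permutations. *)
have -> : Y = \sum_(s : 'S_n) (grad F (y - eta *: W s i) - grad F y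
    - (- (eta *: W s i)) *m hess F y).
  rewrite sumrB -mulmx_suml sumrN -scaler_sumr sum_perm_prefix_sum0; last first.
    exact: sum_dev fL.
  rewrite scaler0 oppr0 mul0mx subr0 /Y scaler_sumr; apply: eq_bigr => s _.
  by rewrite /gm sumrB !(sum_grad n0 fL) -scalerBr scalerA mulVf// scale1r.
apply: (le_trans (enorm_sum _ _ _)).
apply: (@le_trans _ _ (\sum_(s : 'S_n) rho * (eta * enorm (W s i)) `^ (1 + nu))).
  apply: ler_sum => s _.
  have := holder_grad_taylor y (- (eta *: W s i)) nu0 rho0 hessF.
  by rewrite enormN enormZ ger0_norm.
by rewrite -mulr_sumr mulrCA ler_wpM2l// shuffled_powR_mean// ltnW.
Qed.

Lemma inner_grad_bias (i : 'I_n) :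
  \sum_(s : 'S_n) enorm (grad (f (s i)) (inner eta f y s i) -
    grad (f (s i)) (shuffled_point eta f y s i)) <=
  N * (L * (h * g + h * L * (2 * (h * g))) + L * (h * L * 2) * a).
Proof.
apply: (mean_affine_le _ _ shuffle_size_mean) => [|s].
  by rewrite mulr_ge0// mulr_ge0// mulr_ge0.
case: (fL (s i)) => _ /(_ _ _)/le_trans; apply.
have := inner_shuffled_le y L0 eta_ge0 n0 fL s (ltnW (ltn_ord i)).
have := ler_wpM2l (mulr_ge0 h_ge0 L0) (drift_le y L0 eta_ge0 n0 fL s hL).
rewrite -/F -/h -/g.
move: (shuffle_size _ _ _ _) (drift _ _ _ _) (enorm _) => w D e le1 le2.
have := ler_wpM2l L0 (le_trans le2 (lerD (lexx _) le1)); lra.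
Qed.

(** The first line is the cost of moving from inner iterates to shuffled points; the second is
    decoupling plus the Hölder remainder. *)
Definition bias_bound :=
  L * (h * g + h * L * (2 * (h * g))) + L * (h * L * 2) * a +
  (L * eta * (2 * sigma) + rho * (2 * a `^ (1 + nu))).

Lemma epoch_error_bias :
  enorm (\sum_(s : 'S_n) epoch_error eta f y s) <= N * bias_bound.
Proof.
rewrite -scaler_sumr exchange_big enormZ ger0_norm ?invr_ge0//= ler_pdivrMl//.
apply: (le_trans (enorm_sum _ _ _)).
apply: (@le_trans _ _ (\sum_(j < n) N * bias_bound)); last first.
  by rewrite sumr_const card_ord [leRHS]mulr_natl.
apply: ler_sum => j _.
rewrite (eq_bigr (fun s : 'S_n => (grad (f (s j)) (inner eta f y s j) -
    grad (f (s j)) (shuffled_point eta f y s j)) + gm (s j) (W s j))); last first.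
  by move=> s _; rewrite /gm /shuffled_point addrA subrK.
rewrite big_split/= (le_trans (enormD _ _))// mulrDr lerD//; last first.
  exact: shuffled_grad_bias.
by rewrite (le_trans (enorm_sum _ _ _))// inner_grad_bias.
Qed.

End EpochMoments.

(** * The arithmetic of the one-epoch inequality *)

Section OneEpoch.
Context {R : realType}.

Lemma sqr_sum4_le (x1 x2 x3 x4 : R) :
  (x1 + x2 + (x3 + x4)) ^+ 2 <= 4 * (x1 ^+ 2 + x2 ^+ 2 + x3 ^+ 2 + x4 ^+ 2).
Proof.
have := sqr_ge0 (x1 - x2); have := sqr_ge0 (x1 - x3); have := sqr_ge0 (x1 - x4).
have := sqr_ge0 (x2 - x3); have := sqr_ge0 (x2 - x4); have := sqr_ge0 (x3 - x4).
lra.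
Qed.

Lemma small_step (L mu h : R) : 0 < mu -> mu <= L -> 0 <= h ->
  h * L ^+ 2 <= mu / 64 -> h * L <= 64^-1 /\ h * mu <= 64^-1.
Proof.
move=> mu0 muL h0 hL2; have L0 : 0 < L := lt_le_trans mu0 muL.
have hL : h * L <= 64^-1.
  rewrite -(ler_pM2r L0) -mulrA -expr2; apply: (le_trans hL2).
  by rewrite mulrC ler_wpM2l// invr_ge0.
by split=> //; apply: le_trans hL; rewrite ler_wpM2l.
Qed.

Definition epoch_noise (L mu rho h eta sigma a q beta : R) : R :=
  36 * L ^+ 2 * h ^+ 2 * beta ^+ 2 + 9 * mu * L ^+ 2 * h * a ^+ 2 +
  64 * L ^+ 2 * (eta * sigma) ^+ 2 + 64 * rho ^+ 2 * q ^+ 2.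

(** Here [u] is the exact step, [b] the bias and [S] the second moment. Young's inequality splits
    [u * b]; the condition on [h * L ^+ 2] makes every multiple of [r ^+ 2] small against the
    contraction. *)
Lemma one_epoch_arith (L mu rho h eta sigma a q g beta r u b S : R) :
  0 < mu -> mu <= L -> 0 <= h -> h * L ^+ 2 <= mu / 64 -> 0 <= g -> 0 <= beta ->
  0 <= r -> 0 <= a -> 0 <= eta * sigma -> 0 <= rho * q ->
  g <= beta + L * r ->
  u ^+ 2 <= (1 - 2 * (h * mu) + h ^+ 2 * L ^+ 2) * r ^+ 2 ->
  b = L * (h * g + h * L * (2 * (h * g))) + L * (h * L * 2) * a +
    (L * eta * (2 * sigma) + rho * (2 * q)) ->
  S = 8 * L ^+ 2 * (h * g) ^+ 2 + 8 * L ^+ 2 * a ^+ 2 ->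
  u ^+ 2 + 2 * h * (u * b) + h ^+ 2 * S <=
  (1 - h * mu) * r ^+ 2 + h * (epoch_noise L mu rho h eta sigma a q beta / mu).
Proof.
move=> mu0 muL h0 hL2 g0 b0 r0 a0 es0 rq0 gle uu bE SE.
have L0 : 0 < L := lt_le_trans mu0 muL.
have [hL hmu] := small_step mu0 muL h0 hL2.
have g2 : g ^+ 2 <= 2 * beta ^+ 2 + 2 * L ^+ 2 * r ^+ 2.
  have : g ^+ 2 <= (beta + L * r) ^+ 2.
    by rewrite ler_pXn2r ?nnegrE// addr_ge0// mulr_ge0// ltW.
  have := sqr_ge0 (beta - L * r); lra.
have hg0 : 0 <= h * g by rewrite mulr_ge0.
have h2L4 : (h * L ^+ 2) ^+ 2 <= mu / 64 * (h * L ^+ 2).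
  by rewrite expr2 ler_wpM2r// mulr_ge0 ?sqr_ge0.
have h2L4' : (h * L ^+ 2) ^+ 2 <= mu ^+ 2 / 4096.
  apply: (le_trans h2L4); have := ler_wpM2l (ltW mu0) hL2; lra.
have b2 : b ^+ 2 <= 4 * (107 / 100 * L ^+ 2 * h ^+ 2 * g ^+ 2 +
    4 * (h * L ^+ 2) ^+ 2 * a ^+ 2 + 4 * L ^+ 2 * (eta * sigma) ^+ 2 +
    4 * rho ^+ 2 * q ^+ 2).
  rewrite bE; apply: (le_trans (sqr_sum4_le _ _ _ _)).
  (* The factor 107/100 dominates [(1 + 2 / 64) ^+ 2]. *)
  have k : (L * (h * g + h * L * (2 * (h * g)))) ^+ 2 <=
      107 / 100 * L ^+ 2 * h ^+ 2 * g ^+ 2.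
    have -> : (L * (h * g + h * L * (2 * (h * g)))) ^+ 2 =
       (1 + 2 * (h * L)) ^+ 2 * (L * (h * g)) ^+ 2 by ring.
    have -> : 107 / 100 * L ^+ 2 * h ^+ 2 * g ^+ 2 = 107 / 100 * (L * (h * g)) ^+ 2.
      by ring.
    rewrite ler_wpM2r ?sqr_ge0//.
    have hL0 : 0 <= h * L by rewrite mulr_ge0// ltW.
    have : (1 + 2 * (h * L)) ^+ 2 <= (1 + 2 * 64^-1) ^+ 2.
      by rewrite ler_pXn2r ?nnegrE//; clear - hL0 hL; lra.
    by clear; lra.
  by clear - k; lra.
(* Expanded, this is [2 * h * mu * u * b <= h * mu ^+ 2 * u ^+ 2 / 4 + 4 * h * b ^+ 2]; the goal is
   multiplied by [mu] to match. *)
have young : 0 <= h * (mu * u / 2 - 2 * b) ^+ 2 by rewrite mulr_ge0 ?sqr_ge0.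
rewrite -(ler_pM2l mu0).
have -> : mu * ((1 - h * mu) * r ^+ 2 +
      h * (epoch_noise L mu rho h eta sigma a q beta / mu)) =
    mu * (1 - h * mu) * r ^+ 2 + h * epoch_noise L mu rho h eta sigma a q beta.
  by field; rewrite gt_eqF.
(* The rate is [2 - 1/64 - 1/4], rounded down; [e2] and [e3] then spend only 1/100 of it, well
   within the slack above 1. *)
have e1 : mu * (1 + h * mu / 4) * u ^+ 2 <= mu * (1 - 173 / 100 * (h * mu)) * r ^+ 2.
  have t0 : 0 <= h * mu by rewrite mulr_ge0// ltW.
  have t0' : 0 <= 1 + h * mu / 4 by clear - t0; lra.
  apply: (@le_trans _ _ (mu * (1 + h * mu / 4) *
    ((1 - 2 * (h * mu) + h ^+ 2 * L ^+ 2) * r ^+ 2))).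
    by rewrite ler_wpM2l// mulr_ge0// ltW.
  have k : (1 + h * mu / 4) * (1 - 2 * (h * mu) + h ^+ 2 * L ^+ 2) <=
      1 - 173 / 100 * (h * mu).
    apply: (@le_trans _ _ ((1 + h * mu / 4) * (1 - 2 * (h * mu) + h * mu / 64))).
      rewrite ler_wpM2l//.
      by have := ler_wpM2l h0 hL2; clear; lra.
    by have := mulr_ge0 t0 t0; clear - t0; lra.
  by have := ler_wpM2r (sqr_ge0 r) (ler_wpM2l (ltW mu0) k); clear; lra.
have e2 : 4 * h * b ^+ 2 <= h * (3424 / 100 * L ^+ 2 * h ^+ 2 * beta ^+ 2 +
    (9 / 1000) * mu ^+ 2 * r ^+ 2 + mu * (h * L ^+ 2) * a ^+ 2 +
    64 * L ^+ 2 * (eta * sigma) ^+ 2 + 64 * rho ^+ 2 * q ^+ 2).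
  rewrite mulrAC mulrC ler_wpM2l//.
  have k1 := ler_wpM2l (mulr_ge0 (sqr_ge0 L) (sqr_ge0 h)) g2.
  have k2 := ler_wpM2r (sqr_ge0 r) h2L4'.
  have k3 := ler_wpM2r (sqr_ge0 a) h2L4.
  have k4 : 0 <= mu ^+ 2 * r ^+ 2 by rewrite mulr_ge0 ?sqr_ge0.
  by clear - b2 k1 k2 k3 k4; lra.
have e3 : mu * (h ^+ 2 * S) <= h * (L ^+ 2 * h ^+ 2 * beta ^+ 2 +
    mu ^+ 2 * r ^+ 2 / 1000 + 8 * mu * (h * L ^+ 2) * a ^+ 2).
  have -> : mu * (h ^+ 2 * S) = h * (8 * (h * mu) * (L ^+ 2 * h ^+ 2 * g ^+ 2) +
      8 * mu * (h * L ^+ 2) * a ^+ 2) by rewrite SE; ring.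
  rewrite ler_wpM2l// lerD2r.
  have k0 : 0 <= L ^+ 2 * h ^+ 2 * g ^+ 2.
    exact: mulr_ge0 (mulr_ge0 (sqr_ge0 L) (sqr_ge0 h)) (sqr_ge0 g).
  have k1 := ler_wpM2l (mulr_ge0 (sqr_ge0 L) (sqr_ge0 h)) g2.
  have k2 := ler_wpM2r (sqr_ge0 r) h2L4'.
  have k3 := ler_wpM2r k0 hmu.
  have k4 : 0 <= mu ^+ 2 * r ^+ 2 by rewrite mulr_ge0 ?sqr_ge0.
  have k5 : 0 <= L ^+ 2 * h ^+ 2 * beta ^+ 2.
    exact: mulr_ge0 (mulr_ge0 (sqr_ge0 L) (sqr_ge0 h)) (sqr_ge0 beta).
  by clear - k1 k2 k3 k4 k5 h0 mu0 hmu; lra.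
have k4 := mulr_ge0 h0 (mulr_ge0 (sqr_ge0 mu) (sqr_ge0 r)).
have k5 := mulr_ge0 h0 (mulr_ge0 (mulr_ge0 (sqr_ge0 L) (sqr_ge0 h)) (sqr_ge0 beta)).
rewrite /epoch_noise; clear - young e1 e2 e3 k4 k5; lra.
Qed.

End OneEpoch.

(** * Contraction over the epochs *)

Section Recursion.
Context {R : realType}.

Lemma sum_tuple_cons (T : finType) (K : nat) (X : seq T -> R) :
  \sum_(t : K.+1.-tuple T) X t = \sum_(x : T) \sum_(t : K.-tuple T) X (x :: t).
Proof.
rewrite pair_big /=.
rewrite (reindex (fun p : T * K.-tuple T => [tuple of p.1 :: p.2])) //=.
exists (fun t : K.+1.-tuple T => (thead t, [tuple of behead t])).
  by move=> [x t] _; congr (_, _); apply: val_inj.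
by move=> t _; rewrite [in RHS](tuple_eta t).
Qed.

(** Writing the drift as a convex combination with the fixed point [M] keeps its form under
    iteration. The predicate [I] is there because the one-step bound holds only on an invariant
    set. *)
Lemma mean_recursion (T : finType) (Y : Type) (step : T -> Y -> Y) (V : Y -> R)
    (I : Y -> Prop) (q M : R) : 0 <= q ->
  (forall x y, I y -> I (step x y)) ->
  (forall y, I y -> \sum_x V (step x y) <= #|T|%:R * (q * V y + (1 - q) * M)) ->
  forall K y, I y ->
  \sum_(t : K.-tuple T) V (foldl (fun y x => step x y) y t) <=
  #|{: K.-tuple T}|%:R * (q ^+ K * V y + (1 - q ^+ K) * M).
Proof.
move=> q0 Istep Vstep; elim=> [|K IH] y Iy.
  rewrite (big_pred1 [tuple]); last first.
    by move=> t; apply/esym/eqP; rewrite [t]tuple0.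
  by rewrite card_tuple expn0 /= !expr0 subrr mul0r addr0 !mul1r.
rewrite (sum_tuple_cons _ (fun t => V (foldl (fun y x => step x y) y t))) /=.
apply: (@le_trans _ _ (\sum_x #|{: K.-tuple T}|%:R *
    (q ^+ K * V (step x y) + (1 - q ^+ K) * M))).
  by apply: ler_sum => x _; apply: IH; exact: Istep.
rewrite -mulr_sumr !card_tuple expnS natrM -mulrA mulrCA ler_wpM2l//.
rewrite big_split/= -mulr_sumr sumr_const -[_ *+ _]mulr_natl.
apply: (@le_trans _ _ (q ^+ K * (#|T|%:R * (q * V y + (1 - q) * M)) +
    #|T|%:R * ((1 - q ^+ K) * M))).
  by rewrite lerD2r ler_wpM2l ?exprn_ge0// Vstep.
by rewrite exprSr le_eqVlt; apply/orP; left; apply/eqP; ring.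
Qed.

End Recursion.

(** * Invariant ball and mean square recursion *)

Section Iteration.
Context {R : realType} {d n : nat}.
Variables (L mu eta sigma rho nu D : R) (f : 'I_n -> 'rV[R]_d -> R).
Variables (psi : 'rV[R]_d -> \bar R) (xs : 'rV[R]_d).
Let F := mean_fun f.
Let h := n%:R * eta.
Hypotheses (mu0 : 0 < mu) (muL : mu <= L) (eta0 : 0 < eta) (n0 : (0 < n)%N).
Hypotheses (hL2 : h * L ^+ 2 <= mu / 64).
Hypotheses (rho0 : 0 <= rho) (nu0 : 0 < nu) (nu1 : nu <= 1).
Hypothesis fL : forall i, lipschitz_gradient L (f i).
Hypothesis Fmu : strongly_convex mu F.
Hypothesis hessF : holder_hessian rho nu F.
Hypotheses (psip : proper_fun psi) (psic : closed_fun psi) (psix : convex_fun psi).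
Hypothesis xsmin : argmin (fun x => ((F x)%:E + psi x)%E) xs.
Hypothesis D0 : 0 <= D.
Hypothesis GD : Gstar f xs <= 2 * L * D.
Hypothesis sigma_gt : 2 * (Gstar f xs + L * D) < sigma.

Let L_gt0 : 0 < L. Proof. exact: lt_le_trans mu0 muL. Qed.
Let L_ge0 : 0 <= L. Proof. exact: ltW. Qed.
Let n_gt0 : 0 < n%:R :> R. Proof. by rewrite ltr0n. Qed.
Let h_gt0 : 0 < h. Proof. exact: mulr_gt0. Qed.
Let hL : h * L <= 64^-1. Proof. by have [] := small_step mu0 muL (ltW h_gt0) hL2. Qed.
Let hmu : h * mu <= 64^-1. Proof. by have [] := small_step mu0 muL (ltW h_gt0) hL2. Qed.
Let hL_half : h * L <= 2^-1. Proof. by apply: (le_trans hL); lra. Qed.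
Let FL : lipschitz_gradient L F. Proof. exact: lipschitz_gradient_mean. Qed.

Lemma Gstar_ge0 : 0 <= Gstar f xs.
Proof. exact: bigmax_ge_id. Qed.

Definition grad_step_diff y := (y - xs) - h *: (grad F y - grad F xs).

Lemma grad_step_diff_le y : enorm (grad_step_diff y) ^+ 2 <=
  (1 - 2 * (h * mu) + h ^+ 2 * L ^+ 2) * enorm (y - xs) ^+ 2.
Proof.
rewrite enormB_sqr dotZr enormZ ger0_norm ?(ltW h_gt0)// exprMn.
have := strong_monotone L_ge0 (ltW mu0) FL Fmu y xs; rewrite dotC.
have : enorm (grad F y - grad F xs) ^+ 2 <= (L * enorm (y - xs)) ^+ 2.
  rewrite ler_pXn2r ?nnegrE ?enorm_ge0 ?mulr_ge0 ?enorm_ge0//.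
  by case: FL => _; exact.
move: (enorm _) (dot _ _) (enorm _) => A B C AC BC.
have := ler_wpM2l (sqr_ge0 h) AC; have := ler_wpM2l (ltW h_gt0) BC; lra.
Qed.

(** The shift by [h *: grad F xs] in the contraction combines with the epoch to leave the difference
    of two gradient steps, plus the error. *)
Lemma prox_step_le s y :
  enorm (prox h psi (epoch f eta s y) - xs) <=
  enorm (grad_step_diff y - h *: epoch_error eta f y s).
Proof.
apply: (le_trans (prox_contraction _ L_ge0 h_gt0 FL psip psic psix xsmin)).
rewrite (epochE eta y n0 fL) -/h -/F le_eqVlt; apply/orP; left.
by apply/eqP; congr enorm; apply/rowP => j; rewrite !mxE; ring.
Qed.

Lemma grad_comp_le m y : enorm (grad (f m) y) <= Gstar f xs + L * enorm (y - xs).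
Proof.
rewrite -[grad (f m) y](subrK (grad (f m) xs)) addrC (le_trans (enormD _ _))//.
rewrite lerD//; last by case: (fL m) => _; exact.
exact: (le_bigmax _ (fun i => enorm (grad (f i) xs)) m).
Qed.

Lemma grad_mean_le y : enorm (grad F y) <= Gstar f xs + L * enorm (y - xs).
Proof.
rewrite (grad_mean_fun fL) enormZ ger0_norm ?invr_ge0// ler_pdivrMl//.
apply: (le_trans (enorm_sum _ _ _)).
apply: (@le_trans _ _ (\sum_(m < n) (Gstar f xs + L * enorm (y - xs)))).
  by apply: ler_sum => m _; exact: grad_comp_le.
by rewrite sumr_const card_ord [leRHS]mulr_natl.
Qed.

Lemma dev_le y m : enorm (y - xs) <= D -> enorm (dev f y m) <= sigma.
Proof.
move=> yD; apply: (le_trans (enormB _ _)).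
have := grad_comp_le m y; have := grad_mean_le y.
have := ler_wpM2l L_ge0 yD.
move: (enorm _) (enorm _) (enorm _) => a b c; move: sigma_gt; lra.
Qed.

(** Holds for every permutation: the worst-case perturbation is at most [18 / 64 * (h * mu) * D],
    while the gradient step gains [h * mu / 2 * D]. *)
Lemma step_invariant s y : enorm (y - xs) <= D ->
  enorm (prox h psi (epoch f eta s y) - xs) <= D.
Proof.
move=> yD; apply: (le_trans (prox_step_le s y)); apply: (le_trans (enormB _ _)).
have h0 := ltW h_gt0.
have LD : L * enorm (y - xs) <= L * D by rewrite ler_wpM2l.
have gD : enorm (grad F y) <= 3 * (L * D).
  by apply: (le_trans (grad_mean_le y)); move: GD LD; lra.
have wD : shuffle_size eta f y s <= h * (6 * (L * D)).
  rewrite ler_pdivrMl//.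
  apply: (@le_trans _ _ (\sum_(j < n) h * (6 * (L * D)))); last first.
    by rewrite sumr_const card_ord [leRHS]mulr_natl.
  apply: ler_sum => j _; rewrite /h [n%:R * eta]mulrC -mulrA ler_wpM2l ?(ltW eta0)//.
  have dB m : enorm (dev f y m) <= 6 * (L * D).
    apply: (le_trans (enormB _ _)).
    have := grad_comp_le m y; move: gD GD LD; lra.
  apply: (le_trans (prefix_sum_norm_le s (ltnW (ltn_ord j)) dB)).
  by rewrite ler_wpM2r ?ler_nat ?(ltnW (ltn_ord j))// !mulr_ge0.
have eD : enorm (epoch_error eta f y s) <= 18 * (h * L ^+ 2) * D.
  apply: (le_trans (epoch_error_le eta y fL s)).
  have := drift_le y L_ge0 (ltW eta0) n0 fL s hL_half; rewrite -/F -/h => le1.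
  have := ler_wpM2l h0 gD => le2.
  have le3 : drift eta f y s <= 18 * h * L * D by move: le1 le2 wD; lra.
  have := ler_wpM2l L_ge0 le3; lra.
rewrite enormZ ger0_norm//.
have t0 : 0 <= h * mu by rewrite mulr_ge0// ltW.
have uD : enorm (grad_step_diff y) <= (1 - h * mu / 2) * D.
  have c0 : 0 <= 1 - h * mu / 2 by move: hmu; lra.
  rewrite -(@ler_pXn2r _ 2) ?nnegrE ?enorm_ge0 ?mulr_ge0//.
  apply: (le_trans (grad_step_diff_le y)).
  have le1 : enorm (y - xs) ^+ 2 <= D ^+ 2 by rewrite ler_pXn2r ?nnegrE ?enorm_ge0.
  have le2 : 1 - 2 * (h * mu) + h ^+ 2 * L ^+ 2 <= (1 - h * mu / 2) ^+ 2.
    have := ler_wpM2l h0 hL2; have := sqr_ge0 (h * mu); lra.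
  rewrite [(_ * D) ^+ 2]exprMn.
  apply: (@le_trans _ _ ((1 - h * mu / 2) ^+ 2 * enorm (y - xs) ^+ 2)).
    by apply: ler_wpM2r; first exact: sqr_ge0.
  by apply: ler_wpM2l; first exact: sqr_ge0.
have := ler_wpM2l h0 eD.
have := ler_wpM2r D0 (ler_wpM2l h0 hL2).
have := mulr_ge0 t0 D0; move: uD; lra.
Qed.

Let a := eta * Num.sqrt n%:R * sigma.
Let P := epoch_noise L mu rho h eta sigma a (a `^ (1 + nu)) (enorm (grad F xs)).

Let sigma0 : 0 < sigma.
Proof.
by apply: le_lt_trans sigma_gt; rewrite mulr_ge0// addr_ge0 ?Gstar_ge0// mulr_ge0.
Qed.

(** After expanding the square, the cross term sees only the summed error, so the small bias enters
    at order [h] and the larger second moment only at order [h ^+ 2]. *)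
Lemma step_mean y : enorm (y - xs) <= D ->
  \sum_(s : 'S_n) enorm (prox h psi (epoch f eta s y) - xs) ^+ 2 <=
  #|{: 'S_n}|%:R * ((1 - h * mu) * enorm (y - xs) ^+ 2 + h * (P / mu)).
Proof.
move=> yD; have dle m := dev_le m yD.
have h0 := ltW h_gt0.
have bias := epoch_error_bias L_ge0 eta0 n0 sigma0 rho0 nu0 nu1 fL hessF dle hL_half.
have var := epoch_error_second_moment L_ge0 eta0 n0 sigma0 fL dle hL_half.
pose u := grad_step_diff y.
apply: (@le_trans _ _ (\sum_(s : 'S_n) enorm (u - h *: epoch_error eta f y s) ^+ 2)).
  apply: ler_sum => s _.
  by rewrite ler_pXn2r ?nnegrE ?enorm_ge0//; exact: prox_step_le.
have -> : \sum_(s : 'S_n) enorm (u - h *: epoch_error eta f y s) ^+ 2 =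
    #|{: 'S_n}|%:R * enorm u ^+ 2 +
    2 * h * dot (- u) (\sum_(s : 'S_n) epoch_error eta f y s) +
    h ^+ 2 * \sum_(s : 'S_n) enorm (epoch_error eta f y s) ^+ 2.
  rewrite dot_sumr !mulr_sumr mulr_natl -sumr_const -!big_split/=.
  apply: eq_bigr => s _; rewrite enormB_sqr dotZr dotNl enormZ exprMn.
  by rewrite real_normK ?num_real//; ring.
set N := #|_|%:R in bias var *; have N0 : 0 <= N by rewrite ler0n.
set b := bias_bound _ _ _ _ _ _ _ in bias.
pose S := 8 * L ^+ 2 * (h * enorm (grad F y)) ^+ 2 + 8 * L ^+ 2 * a ^+ 2.
apply: (@le_trans _ _ (N * (enorm u ^+ 2 + 2 * h * (enorm u * b) + h ^+ 2 * S))).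
  rewrite 2!(mulrDr N) !lerD//; last by rewrite [leRHS]mulrCA ler_wpM2l ?sqr_ge0.
  rewrite [leRHS]mulrCA ler_wpM2l//; first by rewrite mulr_ge0.
  apply: (le_trans (cauchy_schwarz _ _)); rewrite enormN [leRHS]mulrCA.
  by rewrite ler_wpM2l ?enorm_ge0.
apply: ler_wpM2l => //.
apply: (@one_epoch_arith _ L mu rho h eta sigma a (a `^ (1 + nu))
  (enorm (grad F y)) (enorm (grad F xs)) (enorm (y - xs)) (enorm u)) => //.
- exact: enorm_ge0.
- exact: enorm_ge0.
- exact: enorm_ge0.
- by rewrite !mulr_ge0 ?sqrtr_ge0// ltW.
- by rewrite mulr_ge0// ltW.
- by rewrite mulr_ge0 ?powR_ge0.
- rewrite -[grad F y](subrK (grad F xs)) addrC (le_trans (enormD _ _))// lerD//.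
  by case: FL => _; exact.
- exact: grad_step_diff_le.
Qed.

Lemma proxRR_mean (K : nat) y0 : enorm (y0 - xs) <= D ->
  expect_perms (fun s : K.-tuple 'S_n =>
    enorm (proxRR f psi eta y0 s - xs) ^+ 2) <=
  (1 - h * mu) ^+ K * D ^+ 2 + P / mu ^+ 2.
Proof.
move=> yD.
have t1 : h * mu <= 1 by move: hmu; lra.
have q0 : 0 <= 1 - h * mu by rewrite subr_ge0.
have step y : enorm (y - xs) <= D ->
    \sum_(s : 'S_n) enorm (prox h psi (epoch f eta s y) - xs) ^+ 2 <=
    #|{: 'S_n}|%:R * ((1 - h * mu) * enorm (y - xs) ^+ 2 +
      (1 - (1 - h * mu)) * (P / mu ^+ 2)).
  move=> /step_mean; suff -> : (1 - (1 - h * mu)) * (P / mu ^+ 2) = h * (P / mu) by [].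
  by field; rewrite gt_eqF.
have := mean_recursion q0 (fun s y => @step_invariant s y) step K yD.
rewrite /expect_perms ler_pdivrMr; last first.
  by rewrite ltr0n card_tuple expn_gt0; apply/orP; left; apply/card_gt0P; exists 1%g.
move=> /le_trans; apply; rewrite mulrC ler_wpM2r// lerD//.
  rewrite ler_wpM2l ?exprn_ge0//.
  by rewrite ler_pXn2r ?nnegrE ?enorm_ge0.
rewrite ler_piMl ?divr_ge0 ?sqr_ge0//.
  by rewrite !addr_ge0// !mulr_ge0// ?enorm_ge0 ?powR_ge0 ?sqrtr_ge0// ltW.
by rewrite lerBlDr lerDl exprn_ge0.
Qed.

End Iteration.

(** * Rates *)

Section Rates.
Context {R : realType}.

(** From [expR (- 8^-1) >= 7 / 8], since the eighth power of 8/7 is below 3. *)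
Lemma expR1_le3 : expR 1 <= 3 :> R.
Proof.
have e : expR (8^-1 : R) <= 8 / 7.
  rewrite -[8^-1 : R]opprK expRN invf_ple ?posrE ?expR_gt0//.
  by apply: le_trans (expR_ge1Dx _); lra.
have -> : 1 = 8%:R * 8^-1 :> R by rewrite divff.
rewrite expRM_natl; apply: (@le_trans _ _ ((8 / 7 : R) ^+ 8)); last by lra.
by rewrite ler_pXn2r ?nnegrE ?expR_ge0//; lra.
Qed.

Lemma ln_ge1 (x : R) : 3 <= x -> 1 <= ln x.
Proof.
move=> x3; have x0 : 0 < x by lra.
by rewrite -ler_expR lnK ?posrE// (le_trans expR1_le3).
Qed.

Lemma powR_sqr (x p : R) : 0 <= x -> (x `^ p) ^+ 2 = (x ^+ 2) `^ p.
Proof. by move=> x0; rewrite -(powR_mulrn 2 (powR_ge0 _ _)) -(powR_mulrn 2 x0) powRAC. Qed.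

Lemma powR_invr (x p : R) : 0 <= x -> x^-1 `^ p = (x `^ p)^-1.
Proof. by move=> x0; rewrite -powR_inv1// -powRrM mulN1r powRN. Qed.

Lemma powR_div_sqr (n T nu : R) : 0 <= n -> 0 <= T ->
  n `^ (1 + nu) * T `^ (- 2 - 2 * nu) = (n / T ^+ 2) `^ (1 + nu).
Proof.
move=> n0 T0; rewrite powRM ?invr_ge0 ?sqr_ge0//; congr (_ * _).
rewrite powR_invr ?sqr_ge0// -powR_sqr//.
have -> : - 2 - 2 * nu = - ((1 + nu) * 2%:R) by ring.
by rewrite powRN powRrM powR_mulrn// powR_ge0.
Qed.

(** The base is [w = (n * K ^+ 2)^-1 <= 1], so the exponent may drop to 3/2; then [w * Num.sqrt w]
    is handled by [Num.sqrt w <= K^-1]. *)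
Lemma powR_rate_le (n K nu : R) : 1 <= n -> 1 <= K -> 2^-1 <= nu ->
  (n / (n * K) ^+ 2) `^ (1 + nu) <= (n * K ^+ 3)^-1.
Proof.
move=> n1 K1 nu2.
have n0 : 0 < n by lra.
have K0 : 0 < K by lra.
have -> : n / (n * K) ^+ 2 = (n * K ^+ 2)^-1 by field; rewrite !gt_eqF.
set w := (_ * _)^-1.
have nK1 : 1 <= n * K ^+ 2 by rewrite mulr_ege1// exprn_ege1.
have w0 : 0 < w by rewrite invr_gt0; lra.
have w1 : w <= 1 by rewrite invf_le1//; lra.
apply: (@le_trans _ _ (w `^ (1 + 2^-1))).
  by rewrite ger_powR ?w0// lerD2l.
rewrite powRD; last by rewrite (gt_eqF w0) implybT.
rewrite powRr1 ?(ltW w0)// powR12_sqrt ?(ltW w0)//.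
have sw : Num.sqrt w <= K^-1.
  rewrite -[leRHS]ger0_norm ?invr_ge0 ?(ltW K0)// -sqrtr_sqr ler_wsqrtr//.
  rewrite exprVn lef_pV2 ?posrE ?exprn_gt0//; last by lra.
  by rewrite ler_peMl ?sqr_ge0.
apply: (le_trans (ler_wpM2l (ltW w0) sw)).
by rewrite /w -invfM -mulrA -exprSr.
Qed.

Lemma exp_decay (t : R) (K : nat) (l : R) : t <= 1 -> t * K%:R = 4 * l ->
  (1 - t) ^+ K <= expR (- (4 * l)).
Proof.
move=> t1 <-; rewrite -mulNr expRM_natr lerXn2r ?nnegrE ?expR_ge0 ?subr_ge0//.
exact: expR_ge1Dx.
Qed.

(** The coefficients result from inserting the stepsize into [epoch_noise] over [mu ^+ 2]:
    [36 * 16], [64 * 16] and [9 * 4 * 16]. *)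
Definition rate_constant (L mu rho nu sigma D : R) : R :=
  D ^+ 2 + 576 * L ^+ 2 / mu ^+ 4 + 1024 * L ^+ 2 * sigma ^+ 2 / mu ^+ 4 +
  576 * L ^+ 2 * sigma ^+ 2 / mu ^+ 4 +
  64 * rho ^+ 2 / mu ^+ 2 * (16 * sigma ^+ 2 / mu ^+ 2) `^ (1 + nu).

Lemma rate_terms_ge0 (L mu rho nu sigma : R) : 0 < mu ->
  [/\ 0 <= 576 * L ^+ 2 / mu ^+ 4,
      0 <= 1024 * L ^+ 2 * sigma ^+ 2 / mu ^+ 4,
      0 <= 576 * L ^+ 2 * sigma ^+ 2 / mu ^+ 4 &
      0 <= 64 * rho ^+ 2 / mu ^+ 2 * (16 * sigma ^+ 2 / mu ^+ 2) `^ (1 + nu)].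
Proof.
move=> mu0; have m4 : 0 <= mu ^+ 4 := exprn_ge0 4 (ltW mu0).
have scaled k (x : R) : 0 <= k%:R * x ^+ 2 := mulr_ge0 (ler0n R k) (sqr_ge0 x).
split; first exact: divr_ge0 (scaled _ _) m4.
- exact: divr_ge0 (mulr_ge0 (scaled _ _) (sqr_ge0 _)) m4.
- exact: divr_ge0 (mulr_ge0 (scaled _ _) (sqr_ge0 _)) m4.
- exact: mulr_ge0 (divr_ge0 (scaled _ _) (sqr_ge0 _)) (powR_ge0 _ _).
Qed.

Lemma rate_constant_ge0 (L mu rho nu sigma D : R) : 0 < mu ->
  0 <= rate_constant L mu rho nu sigma D.
Proof.
move=> /(rate_terms_ge0 L rho nu sigma)[c1 c2 c3 c4].
exact: addr_ge0 (addr_ge0 (addr_ge0 (addr_ge0 (sqr_ge0 D) c1) c2) c3) c4.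
Qed.

Lemma epoch_noise_rate (L mu rho nu sigma D beta l n K T h eta a : R) :
  0 < mu -> 1 <= l -> 0 < n -> 0 < K -> T = n * K -> 0 < nu -> nu <= 1 ->
  0 <= sigma ->
  h = 4 * l / (mu * K) -> eta = 4 * l / (mu * T) ->
  a = eta * Num.sqrt n * sigma ->
  D ^+ 2 / T ^+ 2 +
  epoch_noise L mu rho h eta sigma a (a `^ (1 + nu)) beta / mu ^+ 2 <=
  rate_constant L mu rho nu sigma D * l ^+ 4 *
  (beta ^+ 2 / K ^+ 2 + (T ^+ 2)^-1 + n ^+ 2 / T ^+ 3 + (n / T ^+ 2) `^ (1 + nu)).
Proof.
move=> mu0 l1 n0 K0 TE nu0 nu1 s0 hE etaE aE.
have T0 : 0 < T by rewrite TE mulr_gt0.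
have l0 : 0 <= l by lra.
have eta0 : 0 <= eta by rewrite etaE divr_ge0 ?mulr_ge0// ltW.
have a0 : 0 <= a by rewrite aE !mulr_ge0 ?sqrtr_ge0.
have a2 : a ^+ 2 = 16 * sigma ^+ 2 / mu ^+ 2 * l ^+ 2 * (n / T ^+ 2).
  rewrite aE etaE !exprMn sqr_sqrtr ?(ltW n0)//.
  by field; rewrite !gt_eqF.
rewrite /epoch_noise powR_sqr// {2}a2.
set X1 := beta ^+ 2 / K ^+ 2; set X2 := (T ^+ 2)^-1; set X3 := n ^+ 2 / T ^+ 3.
set X4 := (n / T ^+ 2) `^ (1 + nu).
have X1_ge0 : 0 <= X1 by rewrite divr_ge0 ?sqr_ge0.
have X2_ge0 : 0 <= X2 by rewrite invr_ge0 sqr_ge0.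
have X3_ge0 : 0 <= X3 by rewrite divr_ge0 ?sqr_ge0// exprn_ge0// ltW.
have X4_ge0 : 0 <= X4 by exact: powR_ge0.
have l2 : l ^+ 2 <= l ^+ 4 by rewrite ler_weXn2l.
have l3 : l ^+ 3 <= l ^+ 4 by rewrite ler_weXn2l.
have l4 : 1 <= l ^+ 4 by rewrite exprn_ege1.
(* The Hölder term carries the largest power of the logarithm; [nu <= 1] caps it at 4, uniformly in
   [nu]. *)
have lnu : (l ^+ 2) `^ (1 + nu) <= l ^+ 4.
  apply: (@le_trans _ _ ((l ^+ 2) `^ 2%:R)).
    by rewrite ler_powR ?exprn_ege1//; lra.
  by rewrite powR_mulrn ?sqr_ge0// -exprM.
have [c1 c2 c3 c4] := rate_terms_ge0 L rho nu sigma mu0.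
have c0 := sqr_ge0 D.
have s1 : 0 <= 16 * sigma ^+ 2 / mu ^+ 2.
  exact: divr_ge0 (mulr_ge0 (ler0n R 16) (sqr_ge0 sigma)) (sqr_ge0 mu).
have nT : 0 <= n / T ^+ 2 := divr_ge0 (ltW n0) (sqr_ge0 T).
rewrite (powRM _ (mulr_ge0 s1 (sqr_ge0 l)) nT) (powRM _ s1 (sqr_ge0 l)) -/X4.
rewrite /rate_constant.
have -> : D ^+ 2 / T ^+ 2 + (36 * L ^+ 2 * h ^+ 2 * beta ^+ 2 +
    9 * mu * L ^+ 2 * h * a ^+ 2 + 64 * L ^+ 2 * (eta * sigma) ^+ 2 +
    64 * rho ^+ 2 * ((16 * sigma ^+ 2 / mu ^+ 2) `^ (1 + nu) *
      (l ^+ 2) `^ (1 + nu) * X4)) / mu ^+ 2 =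
  D ^+ 2 * X2 + 576 * L ^+ 2 / mu ^+ 4 * (l ^+ 2 * X1) +
  1024 * L ^+ 2 * sigma ^+ 2 / mu ^+ 4 * (l ^+ 2 * X2) +
  576 * L ^+ 2 * sigma ^+ 2 / mu ^+ 4 * (l ^+ 3 * X3) +
  64 * rho ^+ 2 / mu ^+ 2 * (16 * sigma ^+ 2 / mu ^+ 2) `^ (1 + nu) *
    ((l ^+ 2) `^ (1 + nu) * X4).
  rewrite a2 /X1 /X2 /X3 hE etaE TE.
  move: (X4) (_ `^ _) (_ `^ _) => x4 p1 p2.
  by field; rewrite !gt_eqF.
move: (D ^+ 2) (576 * L ^+ 2 / mu ^+ 4) (1024 * L ^+ 2 * sigma ^+ 2 / mu ^+ 4)
  (576 * L ^+ 2 * sigma ^+ 2 / mu ^+ 4) (64 * rho ^+ 2 / mu ^+ 2 * _) c0 c1 c2 c3 c4.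
move=> C0 C1 C2 C3 C4 c0 c1 c2 c3 c4.
set S := X1 + X2 + X3 + X4.
have bound C k X : 0 <= C -> 0 <= k <= l ^+ 4 -> 0 <= X <= S ->
    C * (k * X) <= C * l ^+ 4 * S.
  move=> C_ge0 /andP[k0 kl] /andP[Xge0 XS].
  by rewrite -mulrA ler_wpM2l// ler_pM.
have [S1 S2 S3 S4] : [/\ 0 <= X1 <= S, 0 <= X2 <= S, 0 <= X3 <= S & 0 <= X4 <= S].
  by clear - X1_ge0 X2_ge0 X3_ge0 X4_ge0; rewrite /S; split; apply/andP; split; lra.
have l2' : 0 <= l ^+ 2 <= l ^+ 4 by rewrite sqr_ge0.
have l3' : 0 <= l ^+ 3 <= l ^+ 4 by rewrite exprn_ge0.
have lnu' : 0 <= (l ^+ 2) `^ (1 + nu) <= l ^+ 4 by rewrite powR_ge0.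
have := bound C0 1 X2 c0 (introT andP (conj ler01 l4)) S2.
have := bound _ _ _ c1 l2' S1; have := bound _ _ _ c2 l2' S2.
have := bound _ _ _ c3 l3' S3; have := bound _ _ _ c4 lnu' S4.
rewrite mul1r !mulrDl => b4 b3 b2 b1 b0.
by rewrite !lerD.
Qed.

End Rates.

(** * Choice of constants and final rates *)

Theorem corollary6p5 (R : realType) :
  exists (p : nat) (C : R -> R -> R -> R -> R -> R -> R),
  forall (L mu rho nu : R) (d n K : nat)
    (f : 'I_n -> 'rV[R]_d -> R) (psi : 'rV[R]_d -> \bar R)
    (xdag y0 : 'rV[R]_d),
  let F := mean_fun f in
  let T : R := (n * K)%:R in
  let eta := 4 * ln T / (mu * T) in
  let beta := enorm (grad F xdag) in
  let err := expect_perms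
    (fun s : K.-tuple 'S_n => enorm (proxRR f psi eta y0 s - xdag) ^+ 2) in
  let bound := C L mu rho nu (Gconst L f y0 xdag) (Dconst L f y0 xdag)
    * ln T ^+ p in
  (2 <= n)%N -> (1 <= K)%N -> (3 <= n * K)%N ->
  0 < mu -> mu <= L -> 0 < nu -> nu <= 1 -> 0 <= rho ->
  (forall i, lipschitz_gradient L (f i)) ->
  strongly_convex mu F ->
  holder_hessian rho nu F ->
  proper_fun psi -> closed_fun psi -> convex_fun psi ->
  argmin (fun x => ((F x)%:E + psi x)%E) = [set xdag] ->
  256 * (L ^+ 2 / mu ^+ 2) * ln T <= K%:R ->
  err <= bound * (beta ^+ 2 / K%:R ^+ 2 + (T ^+ 2)^-1
                  + n%:R ^+ 2 / T ^+ 3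
                  + n%:R `^ (1 + nu) * T `^ (- 2 - 2 * nu)) /\
  (2^-1 <= nu ->
   err <= bound * (beta ^+ 2 / K%:R ^+ 2 + ((n%:R * K%:R) ^+ 2)^-1
                   + (n%:R * K%:R ^+ 3)^-1)).
Proof.
(* The deviation bound [2 * G + 1] strictly exceeds twice the gradient bound on the ball, hence is
   positive. The factor 2 serves the case [nu >= 1/2]. *)
exists 4%N, (fun L mu rho nu G D => 2 * rate_constant L mu rho nu (2 * G + 1) D).
move=> L mu rho nu d n K f psi xs y0 F T eta beta err bound.
move=> n2 K1 nK3 mu0 muL nu0 nu1 rho0 fL Fmu hessF psip psic psix xsmin hK.
have L0 : 0 < L := lt_le_trans mu0 muL.
have n0 : (0 < n)%N by exact: leq_trans n2.
have nR : 1 <= n%:R :> R by rewrite ler1n.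
have KR : 1 <= K%:R :> R by rewrite ler1n.
have n_gt0 : 0 < n%:R :> R by rewrite ltr0n.
have K_gt0 : 0 < K%:R :> R by rewrite ltr0n.
have TE : T = n%:R * K%:R by rewrite /T natrM.
have T3 : 3 <= T by rewrite /T ler_nat.
have T0 : 0 < T by rewrite TE mulr_gt0.
pose l := ln T.
have l1 : 1 <= l by exact: ln_ge1.
have eta0 : 0 < eta by rewrite divr_gt0 ?mulr_gt0//; apply: lt_le_trans l1.
have hE : n%:R * eta = 4 * l / (mu * K%:R).
  by rewrite /eta -/l TE; field; rewrite !gt_eqF.
pose D := Dconst L f y0 xs; pose G := Gconst L f y0 xs.
have yD : enorm (y0 - xs) <= D by rewrite /D /Dconst le_max lexx.
have D0 : 0 <= D := le_trans (enorm_ge0 _) yD.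
have GD : Gstar f xs <= 2 * L * D.
  by rewrite mulrC -ler_pdivrMr ?mulr_gt0// /D /Dconst le_max lexx orbT.
have Gs0 := Gstar_ge0 f xs.
have LD0 : 0 <= L * D by rewrite mulr_ge0// ltW.
have GE : G = Gstar f xs + 2 * L * D by [].
have sigma_gt : 2 * (Gstar f xs + L * D) < 2 * G + 1 by rewrite GE; lra.
have sigma0 : 0 <= 2 * G + 1 by rewrite GE; lra.
(* The threshold 256 on [K] is 4, from the stepsize, times 64. *)
have hL2 : n%:R * eta * L ^+ 2 <= mu / 64.
  rewrite hE mulrAC ler_pdivrMr ?mulr_gt0//.
  have := ler_wpM2l (sqr_ge0 mu) hK; rewrite -/l.
  have -> : mu ^+ 2 * (256 * (L ^+ 2 / mu ^+ 2) * l) = 256 * L ^+ 2 * l.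
    by field; rewrite gt_eqF.
  lra.
have := proxRR_mean mu0 muL eta0 n0 hL2 rho0 nu0 nu1 fL Fmu hessF psip psic psix.
rewrite xsmin => /(_ (2 * G + 1) D xs (erefl _) D0 GD sigma_gt K y0 yD); rewrite -/err.
set noise := epoch_noise _ _ _ _ _ _ _ _ _ => err_le.
(* Since [h * mu * K = 4 * ln T], the decay is even [T ^- 4]. *)
have decay : (1 - n%:R * eta * mu) ^+ K <= (T ^+ 2)^-1.
  have t1 : n%:R * eta * mu <= 1.
    by have [_] := small_step mu0 muL (ltW (mulr_gt0 n_gt0 eta0)) hL2; lra.
  apply: (le_trans (exp_decay (l := l) t1 _)).
    by rewrite hE; field; rewrite !gt_eqF.
  rewrite expRN lef_pV2 ?posrE ?exprn_gt0 ?expR_gt0//.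
  apply: (@le_trans _ _ (T ^+ 4)); first by rewrite ler_weXn2l//; lra.
  by rewrite expRM_natl lnK ?posrE.
have rate := @epoch_noise_rate _ L mu rho nu (2 * G + 1) D beta l n%:R K%:R T
  _ eta _ mu0 l1 n_gt0 K_gt0 TE nu0 nu1 sigma0 hE (erefl _) (erefl _).
have {err_le} := le_trans err_le (lerD (ler_wpM2r (sqr_ge0 D) decay) (lexx _)).
rewrite [_^-1 * D ^+ 2]mulrC => /le_trans /(_ rate); rewrite -powR_div_sqr ?ler0n ?(ltW T0)//.
have -> : bound = 2 * (rate_constant L mu rho nu (2 * G + 1) D * l ^+ 4).
  by rewrite /bound mulrA.
have X1 : 0 <= beta ^+ 2 / K%:R ^+ 2 by rewrite divr_ge0 ?sqr_ge0.
have X2 : 0 <= (T ^+ 2)^-1 by rewrite invr_ge0 sqr_ge0.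
have X3 : n%:R ^+ 2 / T ^+ 3 = (n%:R * K%:R ^+ 3)^-1.
  by rewrite TE; field; rewrite !gt_eqF.
have Y0 : 0 <= (n%:R * K%:R ^+ 3)^-1 :> R by rewrite invr_ge0 mulr_ge0// exprn_ge0.
have X4 : 0 <= n%:R `^ (1 + nu) * T `^ (- 2 - 2 * nu) by rewrite mulr_ge0 ?powR_ge0.
have B0 : 0 <= rate_constant L mu rho nu (2 * G + 1) D * l ^+ 4.
  by rewrite mulr_ge0 ?rate_constant_ge0// exprn_ge0//; lra.
rewrite X3 => err_rate; split=> [|nu2]; apply: (le_trans err_rate).
  by rewrite ler_wpM2r ?addr_ge0// ler_peMl//; lra.
(* The third term equals [(n * K ^+ 3)^-1] and the fourth is at most that, which uses up the factor
   2. *)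
have X4_le : n%:R `^ (1 + nu) * T `^ (- 2 - 2 * nu) <= (n%:R * K%:R ^+ 3)^-1.
  by rewrite powR_div_sqr ?ler0n ?(ltW T0)// TE powR_rate_le.
rewrite -TE -[leRHS]mulrA [leRHS]mulrCA; apply: ler_wpM2l => //; lra.
Qed.
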